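(* Let $G$ be a connected graph on $[n]$, closed with respect to its labeling, with $m$ cut vertices $v_1,\ldots,v_m$, written as $G=G_1\cup\cdots\cup G_{m+1}$ where each $G_i$ is a subgraph without cut vertices, $G_i\cap G_{i+1}=\{v_i\}$ for $i=1,\ldots,m$, and $G_i\cap G_j=\emptyset$ for $j\notin\{i-1,i,i+1\}$. Let $n_i=|V(G_i)|$, let $\mu(G_i)=(\mu_{i1},\ldots,\mu_{in_i})$ and $s_i:=\min\{k-1:\mu_{ik}=0\}$. If for every $i$ we have $s_i\ge1$ and $\mu_{i1}=\cdots=\mu_{is_i}=:\mu_i\ge1$, then $$\beta_p(J_G)=\beta_{p,p+r}(J_G)=\beta_p(\operatorname{in}(J_G))=\beta_{p,p+r}(\operatorname{in}(J_G))=\prod_{i=1}^{m+1}s_i\mu_i,$$ where $p:=\operatorname{pd}(J_G)=2n-3-\sum_{i=1}^{m+1}(\mu_i+s_i)$ and $r:=\operatorname{reg}(J_G)=2m+3$.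
   Context: $G$ is closed with respect to its labeling if whenever $\{i,j\},\{i,k\}\in E(G)$ with either $i<j$, $i<k$ or $i>j$, $i>k$, then $\{j,k\}\in E(G)$. For a graph $F$ on vertices labeled $1,\ldots,N$ (for $G_i$, its vertices relabeled $1,\ldots,n_i$ preserving the order of the labels in $G$), $\mu(F)=(\mu_1,\ldots,\mu_N)$ with $\mu_j=N-j-\deg^>_F(j)$, where $\deg^>_F(j)=|\{l>j:\{j,l\}\in E(F)\}|$. The binomial edge ideal $J_G\subseteq S=k[x_1,\ldots,x_n,y_1,\ldots,y_n]$ ($k$ a field) is generated by $x_iy_j-x_jy_i$ for $\{i,j\}\in E(G)$, $i<j$; $\operatorname{in}(J_G)$ is its initial ideal for the lexicographic order with $x_1>\cdots>x_n>y_1>\cdots>y_n$. $\beta_{i,j}(I)=\dim_k\operatorname{Tor}^S_{i+1}(S/I;k)_j$, $\beta_i=\sum_j\beta_{i,j}$; $\operatorname{pd}$, $\operatorname{reg}$ are projective dimension and regularity. *)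

(* Defs.v *)
From HB Require Import structures.
From mathcomp Require Import all_boot all_order all_algebra.
From mathcomp Require Import mpoly.
Set Implicit Arguments. Unset Strict Implicit. Unset Printing Implicit Defensive.
Import Order.TTheory GRing.Theory.
Local Open Scope ring_scope.

(* Graphs on [n] : vertices 'I_n (label i+1 <-> ordinal i, order kept) *)

Definition simple_graph n (G : rel 'I_n) : Prop :=
  (forall i, ~~ G i i) /\ (forall i j, G i j = G j i).

Definition closed_graph n (G : rel 'I_n) : Prop :=
  forall i j k : 'I_n, G i j -> G i k -> j != k ->
    ((i < j)%N && (i < k)%N) || ((j < i)%N && (k < i)%N) -> G j k.

Definition induced n (G : rel 'I_n) (X : {set 'I_n}) : rel 'I_n :=
  [rel a b | [&& a \in X, b \in X & G a b]].

Definition connected_on n (G : rel 'I_n) (X : {set 'I_n}) : Prop :=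
  forall a b, a \in X -> b \in X -> connect (induced G X) a b.

Definition cut_vertex n (G : rel 'I_n) (X : {set 'I_n}) (v : 'I_n) : Prop :=
  v \in X /\ exists a b, [/\ a \in X :\ v, b \in X :\ v,
     connect (induced G X) a b & ~~ connect (induced G (X :\ v)) a b].

Definition deg_gt n (G : rel 'I_n) (X : {set 'I_n}) (u : 'I_n) : nat :=
  #|[set w in X | (u < w)%N && G u w]|.

(* vertices of X listed increasingly: the relabeling 1..|X| *)
Definition sortedV n (X : {set 'I_n}) : seq 'I_n :=
  sort (fun a b : 'I_n => (a <= b)%N) (enum X).

(* mu(F) = (mu_1,...,mu_N), stored 0-based: nth 0 (mu_seq G X) (k-1) = mu_k *)
Definition mu_seq n (G : rel 'I_n) (X : {set 'I_n}) : seq nat :=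
  let s := sortedV X in
  if s is d :: _ then
    [seq (size s - k.+1 - deg_gt G X (nth d s k))%N | k <- iota 0 (size s)]
  else [::].

Definition s_of n (G : rel 'I_n) (X : {set 'I_n}) : nat :=
  find (fun x => x == 0%N) (mu_seq G X).

Definition mu1_of n (G : rel 'I_n) (X : {set 'I_n}) : nat :=
  nth 0%N (mu_seq G X) 0.

(* S = k[x_1..x_n, y_1..y_n] as {mpoly k[n+n]}:
   x_i = 'X_(lshift n i), y_i = 'X_(rshift n i);  variable order
   x_1 > ... > x_n > y_1 > ... > y_n  is the index order 0 < 1 < ... *)

Section Polys.
Variable k : fieldType.
Variable N : nat.
Local Notation poly := {mpoly k[N]}.

Definition hom_deg (d : nat) (p : poly) : bool :=
  all (fun m : 'X_{1..N} => mdeg m == d) (msupp p).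

Definition ltlex (m1 m2 : 'X_{1..N}) : bool :=
  [exists t : 'I_N, ((m1 t < m2 t)%N &&
     [forall s : 'I_N, (s < t)%N ==> (m1 s == m2 s)])].

Definition is_lead (f : poly) (m : 'X_{1..N}) : Prop :=
  m \in msupp f /\ forall m', m' \in msupp f -> m' != m -> ltlex m' m.

Definition initial_ideal (I : poly -> Prop) (f : poly) : Prop :=
  exists (r : nat) (q g : 'I_r -> poly) (lm : 'I_r -> 'X_{1..N}),
    (forall l, [/\ I (g l), g l != 0 & is_lead (g l) (lm l)]) /\
    f = \sum_(l < r) q l * 'X_[lm l].

(* ---- Koszul complex K(X_0..X_{N-1}; S), graded, basis e_A, A subset *)
Definition chain := {ffun {set 'I_N} -> poly}.

(* c lies in homological degree i and internal degree j:
   c = sum_{|A|=i} e_A (x) c_A with c_A homogeneous of degree j - i *)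
Definition chain_in (i j : nat) (c : chain) : Prop :=
  forall A, c A != 0 -> [/\ #|A| = i, (i <= j)%N & hom_deg (j - i) (c A)].

(* d(e_A) = sum_{t in A} (-1)^{#{s in A, s < t}} x_t e_{A \ t} *)
Definition kdiff (c : chain) : chain :=
  [ffun B : {set 'I_N} =>
     \sum_(t : 'I_N | t \notin B)
        (-1) ^+ #|[set s in B | (s < t)%N]| * 'X_t * c (t |: B)].

Definition in_I (I : poly -> Prop) (c : chain) : Prop := forall A, I (c A).

(* cycles / boundaries of K (x) S/I, lifted to K *)
Definition kcycle I i j (c : chain) : Prop := chain_in i j c /\ in_I I (kdiff c).
Definition kbdry I i j (c : chain) : Prop :=
  chain_in i j c /\ exists b, chain_in i.+1 j b /\ in_I I (c - kdiff b).

Definition lincomb d (a : 'I_d -> k) (z : 'I_d -> chain) : chain :=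
  [ffun A => \sum_(l < d) a l *: z l A].

(* dim_k H_i(K(x; S/I))_j = dim_k Tor_i^S(S/I, k)_j = d *)
Definition tor_dim (I : poly -> Prop) (i j d : nat) : Prop :=
  exists z : 'I_d -> chain,
    [/\ forall l, kcycle I i j (z l),
        forall a : 'I_d -> k, kbdry I i j (lincomb a z) -> forall l, a l = 0
      & forall c, kcycle I i j c -> exists a, kbdry I i j (c - lincomb a z)].

(* beta_{i,j}(I) = dim_k Tor_{i+1}^S(S/I; k)_j *)
Definition betti (I : poly -> Prop) (i j b : nat) : Prop := tor_dim I i.+1 j b.

Definition betti_total (I : poly -> Prop) (i b : nat) : Prop :=
  exists (J : nat) (bs : nat -> nat),
    [/\ forall j, betti I i j (bs j), forall j, (J < j)%N -> bs j = 0%N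
      & b = (\sum_(j < J.+1) bs j)%N].

Definition is_pd (I : poly -> Prop) (p : nat) : Prop :=
  (exists j b, betti I p j b /\ (0 < b)%N) /\
  forall i j, (p < i)%N -> betti I i j 0.

Definition is_reg (I : poly -> Prop) (r : nat) : Prop :=
  (exists i b, betti I i (i + r) b /\ (0 < b)%N) /\
  forall i j, (i + r < j)%N -> betti I i j 0.

End Polys.

Definition xv (k : fieldType) n (i : 'I_n) : {mpoly k[n + n]} := 'X_(lshift n i).
Definition yv (k : fieldType) n (i : 'I_n) : {mpoly k[n + n]} := 'X_(rshift n i).

Definition binom_edge_ideal (k : fieldType) n (G : rel 'I_n)
  (f : {mpoly k[n + n]}) : Prop :=
  exists a : 'I_n -> 'I_n -> {mpoly k[n + n]},
    f = \sum_(i : 'I_n) \sum_(j : 'I_n | (i < j)%N && G i j)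
          a i j * (xv k i * yv k j - xv k j * yv k i).

(* Main.v *)
(** A closed labeling makes the quadrics [x_i y_j - x_j y_i] a Groebner basis:
    the rewriting [x_i y_j -> x_j y_i] ([i < j] an edge) is confluent, so [S/J]
    and [S/in(J)] share the basis of standard monomials, those divisible by no
    [x_i y_j]; products of basis elements agree up to terms of smaller weight.

    The [G_i] are intervals [[a, e]] and [G] restricted to one of them misses
    exactly the pairs [u < a + s], [w > c] with [c = e - mu].  The standard
    monomials are partitioned into pieces [g * k[free variables]], one for each
    choice, in every interval, of the largest [y]-index [j] and the smallest
    [x]-index [i] below [j].  A non-free variable makes a monomial of the piece
    nonstandard or moves it to an earlier piece.  Toggling the first free
    variable is then a matching on the cells [e_A * m] of the Koszul complex for
    which the differential is triangular, both for [J] and for [in(J)]; the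
    unmatched cells are [e_A * g] with [A] contained in the set of non-free
    variables.

    A piece has at most [sum (2(e-a) - mu - s) = p + 1] non-free variables and a
    generator of degree at most [2(m+1) = r - 1].  Both maxima are attained
    exactly when every interval contributes a pair [a <= i < a + s], [c < j <= e],
    which happens [prod s mu] times, and the neighbouring strands have no
    unmatched cells, so these cells form a basis of the homology. *)
Require Import Defs.
From HB Require Import structures.
From mathcomp Require Import all_boot all_order all_algebra.
From mathcomp Require Import mpoly.
From mathcomp Require Import ssrcomplements zify.

Set Implicit Arguments. Unset Strict Implicit. Unset Printing Implicit Defensive.
Import Order.TTheory GRing.Theory.
Local Open Scope ring_scope.

(** * Koszul homology as matrix ranks *)

Section LinearExtension.
Variables (k : fieldType) (N : nat) (g : 'X_{1..N} -> {mpoly k[N]}).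

Definition linext (f : {mpoly k[N]}) : {mpoly k[N]} :=
  \sum_(m <- msupp f) f@_m *: g m.

(** A common index set for several polynomials makes the sum additive term by term; this is what
    gives linearity of [linext]. *)
Lemma linext_widen d f : (msize f <= d)%N ->
  linext f = \sum_(m : 'X_{1..N < d}) f@_m *: g m.
Proof.
move=> hd; rewrite /linext.
pose I : subFinType _ := 'X_{1..N < d}.
rewrite (big_mksub I) //=; first last.
- by move=> x /msize_mdeg_lt /leq_trans; apply.
- by rewrite msupp_uniq.
rewrite big_rmcond //= => m; rewrite mcoeff_msupp negbK => /eqP->.
by rewrite scale0r.
Qed.

Lemma linext_is_linear : linear linext.
Proof.
move=> a f h.
pose d := maxn (msize (a *: f + h)) (maxn (msize f) (msize h)).
rewrite !(@linext_widen d) ?leq_max ?leqnn ?orbT //.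
rewrite scaler_sumr -big_split; apply: eq_bigr => m _.
by rewrite mcoeffD mcoeffZ scalerDl scalerA.
Qed.

HB.instance Definition _ := GRing.isLinear.Build k {mpoly k[N]} {mpoly k[N]} *:%R
  linext linext_is_linear.

Lemma linextX m : linext 'X_[m] = g m.
Proof. by rewrite /linext msuppX big_seq1 mcoeffX eqxx scale1r. Qed.

End LinearExtension.

(** [None] stands for a monomial that reduces to $0$. Modulo $J$ every monomial reduces to a
    monomial; modulo the initial ideal a nonstandard one vanishes. *)
Definition mon (k : fieldType) (N : nat) (o : option 'X_{1..N}) : {mpoly k[N]} :=
  if o is Some m then 'X_[m] else 0.

Section Koszul.
Variables (k : fieldType) (N : nat).
Local Notation poly := {mpoly k[N]}.
Local Notation chain := (@chain k N).

Lemma hom_degD d (p q : poly) : hom_deg d p -> hom_deg d q -> hom_deg d (p + q).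
Proof.
move=> /allP hp /allP hq; apply/allP => m /msuppD_le; rewrite mem_cat.
by case/orP; [apply: hp | apply: hq].
Qed.

Lemma hom_deg0 d : hom_deg d (0 : poly).
Proof. by apply/allP => m; rewrite mcoeff_msupp mcoeff0 eqxx. Qed.

Lemma hom_deg_sum d (T : Type) (r : seq T) (P : pred T) (F : T -> poly) :
  (forall t, P t -> hom_deg d (F t)) -> hom_deg d (\sum_(t <- r | P t) F t).
Proof.
move=> h; apply: (big_ind (fun p : poly => hom_deg d p)) => //.
- exact: hom_deg0.
- exact: hom_degD.
Qed.

Lemma hom_degZ d a (p : poly) : hom_deg d p -> hom_deg d (a *: p).
Proof. by move=> /allP h; apply/allP => m /msuppZ_le; apply: h. Qed.

Lemma hom_degX m : hom_deg (mdeg m) ('X_[m] : poly).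
Proof. by rewrite /hom_deg msuppX /= eqxx. Qed.

Lemma hom_degM d e (p q : poly) :
  hom_deg d p -> hom_deg e q -> hom_deg (d + e) (p * q).
Proof.
move=> /allP hp /allP hq; apply/allP => m /msuppM_le /allpairsP [[a b] /= [ha hb ->]].
by rewrite mdegD (eqP (hp _ ha)) (eqP (hq _ hb)).
Qed.

Lemma kdiffE (c : chain) B : kdiff c B =
  \sum_(t : 'I_N | t \notin B)
        (-1) ^+ #|[set s in B | (s < t)%N]| * 'X_t * c (t |: B).
Proof. by rewrite ffunE. Qed.

Lemma kdiff_is_linear : linear (@kdiff k N : chain -> chain).
Proof.
move=> a c e; apply/ffunP => B; rewrite !ffunE.
rewrite scaler_sumr -big_split; apply: eq_bigr => t _.
by rewrite !ffunE mulrDr scalerAr.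
Qed.

HB.instance Definition _ := GRing.isLinear.Build k chain chain *:%R
  (@kdiff k N) kdiff_is_linear.

Lemma signZ d (p : poly) : (-1) ^+ d * p = (-1) ^+ d *: p.
Proof. by rewrite -mul_mpolyC rmorphXn rmorphN rmorph1. Qed.

Lemma kdiff_in i j (c : chain) : chain_in i.+1 j c -> chain_in i j (kdiff c).
Proof.
move=> hc B hB.
have [t tB cB] : exists2 t, t \notin B & c (t |: B) != 0.
  apply/exists_inP; apply: contraR hB; rewrite negb_exists_in => /forall_inP h.
  rewrite kdiffE big1 // => t tB; move: (h t tB); rewrite negbK => /eqP ->.
  by rewrite mulr0.
have [card lij _] := hc _ cB; move: card; rewrite cardsU1 tB => -[card].
split => //; first by apply: ltnW.
rewrite kdiffE; apply: hom_deg_sum => s sB.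
have [->|cs] := eqVneq (c (s |: B)) 0; first by rewrite mulr0 hom_deg0.
have [_ _ hh] := hc _ cs.
rewrite -mulrA signZ; apply: hom_degZ.
have -> : (j - i = mdeg U_(s) + (j - i.+1))%N by rewrite mdeg1; lia.
by apply: hom_degM => //; apply: hom_degX.
Qed.

Lemma kdiff_kdiff (c : chain) : kdiff (kdiff c) = 0.
Proof.
apply/ffunP => B; rewrite kdiffE ffunE.
pose ps (t : 'I_N) := #|[set s in B | (s < t)%N]|.
pose F (t s : 'I_N) : poly := (-1) ^+ (ps t + ps s) * ('X_t * 'X_s) * c (s |: (t |: B)).
have Fsym t s : F t s = F s t.
  by rewrite /F addnC (mulrC 'X_t) setUCA.
(* Adjoining $t$ to $B$ shifts the position of $s$ by one exactly when $t<s$. So the two orders of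
   removing $s$ and $t$ carry opposite signs, and the symmetric terms [F t s] cancel. *)
have E t : t \notin B -> (-1) ^+ ps t * 'X_t * kdiff c (t |: B) =
   \sum_(s | (s \notin B) && (s < t)%N) F t s
   - \sum_(s | (s \notin B) && (t < s)%N) F t s.
  move=> tB; rewrite kdiffE mulr_sumr.
  rewrite (bigID (fun s : 'I_N => (s < t)%N)) /=; congr (_ + _).
    apply: eq_big => s.
      by rewrite !inE negb_or; case: (eqVneq s t) => [->|] //=; rewrite ltnn andbF.
    case/andP; rewrite !inE negb_or => /andP [sn sB] st.
    have -> : [set x in t |: B | (x < s)%N] = [set x in B | (x < s)%N].
      apply/setP => x; rewrite !inE; case: eqVneq => [->|] //=.
      by rewrite andbC ltnNge ltnW //= andbF.
    by rewrite /F exprD -!mulrA; congr (_ * _); rewrite mulrCA.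
  rewrite -sumrN; apply: eq_big => s.
    rewrite !inE negb_or -leqNgt leq_eqVlt -val_eqE /= eq_sym.
    by case: (s \notin B) => /=; rewrite ?andbF // !andbT; case: (ltngtP t s).
  case/andP; rewrite !inE negb_or => /andP [sn sB]; rewrite -leqNgt => ts.
  have {}ts : (t < s)%N by rewrite ltn_neqAle ts andbT eq_sym.
  have -> : #|[set x in t |: B | (x < s)%N]| = (ps s).+1.
    rewrite /ps -add1n; have -> : 1%N = (t \notin [set x in B | (x < s)%N]).
      by rewrite inE (negbTE tB).
    rewrite -cardsU1; apply: eq_card => x; rewrite !inE.
    by case: eqVneq => [->|].
  rewrite exprS mulN1r !mulNr mulrN; congr (- _).
  by rewrite /F exprD -!mulrA; congr (_ * _); rewrite mulrCA.
rewrite (eq_bigr _ E) sumrB; apply/eqP; rewrite subr_eq0; apply/eqP.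
rewrite [LHS](exchange_big_dep (fun t => t \notin B)) /=; last by move=> t s _ /andP [].
apply: eq_bigr => s sB; apply: eq_big => [t|t _]; last exact: Fsym.
by rewrite sB.
Qed.

End Koszul.

(** * Tor dimensions of a quotient with a monomial basis *)

Section TorRank.
Variables (k : fieldType) (N : nat).
Variables (std : pred 'X_{1..N}) (nfm : 'X_{1..N} -> option 'X_{1..N}).
Local Notation poly := {mpoly k[N]}.
Local Notation chain := (@chain k N).
(** Under the hypotheses below this is the projection onto the span of the standard monomials with
    kernel [I]. *)
Definition nf : poly -> poly := linext (fun m => mon k (nfm m)).
Variable I : poly -> Prop.
Hypothesis nfm_std : forall m, std m -> nfm m = Some m.
Hypothesis nfm_some : forall m m', nfm m = Some m' -> std m' /\ mdeg m' = mdeg m.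
Hypothesis I_nf : forall f, I f <-> nf f = 0.
Hypothesis I_mulX : forall f t, I f -> I ('X_t * f).

HB.instance Definition _ := GRing.Linear.on nf.

Lemma nf_sum (T : Type) (r : seq T) (P : pred T) (F : T -> poly) :
  nf (\sum_(t <- r | P t) F t) = \sum_(t <- r | P t) nf (F t).
Proof. exact: linear_sum. Qed.

Lemma nfZ a f : nf (a *: f) = a *: nf f.
Proof. exact: linearZ. Qed.

(** The products $e_A m$ with $m$ standard form a basis of one bidegree of the Koszul complex over
    $S/I$. The bound [j.+1] only makes the type finite: no monomial of such a cell has degree above
    $j$. *)
Definition cells (i j : nat) : {set {set 'I_N} * 'X_{1..N < j.+1}} :=
  [set z : {set 'I_N} * 'X_{1..N < j.+1} |
    [&& #|z.1| == i, (#|z.1| + mdeg z.2 == j)%N & std z.2]].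

Definition cell i j (l : 'I_#|cells i j|) : ({set 'I_N} * 'X_{1..N < j.+1})%type :=
  enum_val l.

Lemma cellP i j (l : 'I_#|cells i j|) :
  [&& #|(cell l).1| == i, (#|(cell l).1| + mdeg (cell l).2 == j)%N & std (cell l).2].
Proof. by have := enum_valP l; rewrite inE. Qed.

Lemma cell_inj i j : injective (@cell i j).
Proof. exact: enum_val_inj. Qed.

Definition ebas (A : {set 'I_N}) (m : 'X_{1..N}) : chain :=
  [ffun B => if B == A then 'X_[m] else 0].

Definition coords i j (c : chain) : 'rV[k]_#|cells i j| :=
  \row_l (nf (c (cell l).1))@_(cell l).2.

Definition lift_row i j (v : 'rV[k]_#|cells i j|) : chain :=
  \sum_l v 0 l *: ebas (cell l).1 (cell l).2.

Definition dmx i j : 'M[k]_(#|cells i.+1 j|, #|cells i j|) :=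
  \matrix_l coords i j (kdiff (ebas (cell l).1 (cell l).2)).

Lemma coords_is_linear i j : linear (coords i j).
Proof.
by move=> a c e; apply/rowP => l; rewrite !mxE !ffunE linearP mcoeffD mcoeffZ.
Qed.

HB.instance Definition _ i j := GRing.isLinear.Build k chain 'rV[k]_#|cells i j| *:%R
  (coords i j) (@coords_is_linear i j).

Lemma lift_row_is_linear i j : linear (@lift_row i j).
Proof.
move=> a v w; rewrite /lift_row scaler_sumr -big_split; apply: eq_bigr => l _.
by rewrite !mxE scalerDl scalerA.
Qed.

HB.instance Definition _ i j := GRing.isLinear.Build k 'rV[k]_#|cells i j| chain *:%R
  (@lift_row i j) (@lift_row_is_linear i j).

Lemma nf_std m : std m -> nf 'X_[m] = 'X_[m].
Proof. by move=> h; rewrite /nf linextX nfm_std. Qed.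

Lemma idealZ a f : I f -> I (a *: f).
Proof. by move=> /I_nf hf; apply/I_nf; rewrite linearZ /= hf scaler0. Qed.

Lemma ideal_sum (T : Type) (r : seq T) (P : pred T) (F : T -> poly) :
  (forall t, P t -> I (F t)) -> I (\sum_(t <- r | P t) F t).
Proof.
move=> h; apply/I_nf; rewrite linear_sum /= big1 // => t /h.
by move/I_nf.
Qed.

Lemma in_I_kdiff c : in_I I c -> in_I I (kdiff c).
Proof.
move=> h A; rewrite kdiffE; apply: ideal_sum => t _.
by rewrite -mulrA signZ; apply/idealZ/I_mulX/h.
Qed.

Lemma chain_in_sub i j (c e : chain) :
  chain_in i j c -> chain_in i j e -> chain_in i j (c - e).
Proof.
move=> hc he A; rewrite !ffunE => hA.
have [c0|cA] := eqVneq (c A) 0.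
  have eA : e A != 0 by move: hA; rewrite c0 sub0r oppr_eq0.
  have [h1 h2 h3] := he _ eA; split=> //.
  by rewrite c0 sub0r -scaleN1r hom_degZ.
have [h1 h2 h3] := hc _ cA; split=> //; apply: hom_degD => //.
have [->|eA] := eqVneq (e A) 0; first by rewrite oppr0 hom_deg0.
by have [_ _ h4] := he _ eA; rewrite -scaleN1r hom_degZ.
Qed.

Lemma lift_row_in i j v : chain_in i j (@lift_row i j v).
Proof.
move=> A; rewrite /lift_row sum_ffunE => hA.
have [l] : exists l, (v 0 l *: ebas (cell l).1 (cell l).2) A != 0.
  apply/existsP; apply: contraR hA; rewrite negb_exists => /forallP h.
  by rewrite big1 // => l _; move: (h l); rewrite negbK => /eqP.
rewrite !ffunE; case: (A =P (cell l).1) => [->|]; last by rewrite scaler0 eqxx.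
have := cellP l => /and3P [/eqP card /eqP deg _] _.
have lij : (i <= j)%N by lia.
split => //; apply: hom_deg_sum => l' _; rewrite !ffunE.
case: eqP => [h|_]; last by rewrite scaler0 hom_deg0.
have := cellP l' => /and3P [/eqP card' /eqP deg' _].
apply: hom_degZ; have -> : (j - i = mdeg (cell l').2)%N by lia.
exact: hom_degX.
Qed.
Arguments lift_row_in [i j] v A _.

Lemma lift_rowK i j : cancel (@lift_row i j) (coords i j).
Proof.
move=> v; rewrite linear_sum /=; apply/rowP => l; rewrite summxE.
rewrite (bigD1 l) //= linearZ /= mxE big1 ?addr0.
  rewrite mxE ffunE eqxx nf_std ?mcoeffX ?eqxx ?mulr1 //.
  by have := cellP l => /and3P [].
move=> l' hl; rewrite linearZ /= !mxE ffunE.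
case: eqP => [h|_]; last by rewrite linear0 mcoeff0 mulr0.
rewrite nf_std ?mcoeffX; last by have := cellP l' => /and3P [].
case: eqP => [h'|_]; last by rewrite mulr0.
case/eqP: hl; apply: cell_inj.
move: h h'; case: (cell l) => A m; case: (cell l') => A' m' /= -> h.
by congr (_, _); apply: val_inj.
Qed.

Lemma nf_hom_supp d f m : hom_deg d f -> (nf f)@_m != 0 -> std m /\ mdeg m = d.
Proof.
move=> /allP hf; rewrite -mcoeff_msupp /nf /linext => /msupp_sum_le.
move/flattenP => [s /mapP [m0]]; rewrite filter_predT => hm0 -> /msuppZ_le.
case E: (nfm m0) => [m'|] /=; last by rewrite mcoeff_msupp mcoeff0 eqxx.
rewrite msuppX inE => /eqP ->.
by have [? ->] := nfm_some E; split=> //; apply/eqP/hf.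
Qed.

(** Reduction keeps the degree, so the normal form of a homogeneous coefficient involves only
    monomials that occur in cells of this bidegree. *)
Lemma in_I_coords i j c : chain_in i j c -> (in_I I c <-> coords i j c = 0).
Proof.
move=> hc; split=> [h|h A].
  by apply/rowP => l; rewrite !mxE; move/I_nf: (h (cell l).1) => ->; rewrite mcoeff0.
apply/I_nf/mpolyP => m; rewrite mcoeff0.
have [->|cA] := eqVneq (c A) 0; first by rewrite linear0 mcoeff0.
have [card lij hom] := hc _ cA.
apply/eqP/negPn/negP => hm; have [stdm degm] := nf_hom_supp hom hm.
have lt : (mdeg m < j.+1)%N by lia.
have hz : (A, BMultinom lt) \in cells i j.
  by rewrite inE /= card eqxx stdm degm; apply/andP; split => //; apply/eqP; lia.
move/rowP: h => /(_ (enum_rank_in hz (A, BMultinom lt))).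
by rewrite !mxE /cell enum_rankK_in //=; apply/eqP.
Qed.

(** A chain differs from the lift of its coordinates by a chain in [I], and the differential
    preserves such chains, so it may be evaluated on the lift. *)
Lemma coords_kdiff i j c : chain_in i.+1 j c ->
  coords i j (kdiff c) = coords i.+1 j c *m dmx i j.
Proof.
move=> hc; have hr := lift_row_in (coords i.+1 j c).
have h0 : in_I I (c - lift_row (coords i.+1 j c)).
  apply/(@in_I_coords i.+1 j); first exact: chain_in_sub.
  by rewrite linearB /= lift_rowK subrr.
have : in_I I (kdiff (c - lift_row (coords i.+1 j c))) by apply: in_I_kdiff.
move/(@in_I_coords i j) => h1.
have {}h1 := h1 (kdiff_in (chain_in_sub hc hr)).
move: h1; rewrite !linearB /= => /eqP; rewrite subr_eq0 => /eqP ->.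
rewrite /lift_row !linear_sum /= mulmx_sum_row; apply: eq_bigr => l _.
by rewrite !linearZ /= rowK.
Qed.

Lemma dmx_mul i j : dmx i.+1 j *m dmx i j = 0.
Proof.
apply/row_matrixP => l; rewrite row0 row_mul rowK -coords_kdiff.
  by rewrite kdiff_kdiff linear0.
apply: kdiff_in.
have -> : ebas (cell l).1 (cell l).2 = lift_row (delta_mx 0 l).
  rewrite /lift_row (bigD1 l) //= mxE !eqxx scale1r big1 ?addr0 // => l' hl.
  by rewrite mxE (negbTE hl) andbF scale0r.
exact: lift_row_in.
Qed.

(** This is the dimension of the kernel of one differential minus the rank of the preceding one. The
    composite of the two is zero, so the subtractions are not truncated. *)
Lemma tor_dim_rank i j :
  tor_dim I i.+1 j (#|cells i.+1 j| - \rank (dmx i j) - \rank (dmx i.+1 j)).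
Proof.
set K := kermx (dmx i j); set Bd := dmx i.+1 j.
have sBK : (Bd <= K)%MS by apply/sub_kermxP/dmx_mul.
(* A complement of the boundaries inside the cycles; lifting a basis of it yields the
   representatives required by [tor_dim]. *)
pose Q := (K :\: Bd)%MS.
have rQ : \rank Q = (#|cells i.+1 j| - \rank (dmx i j) - \rank Bd)%N.
  have := mxrank_cap_compl K Bd; rewrite -/Q.
  have -> : \rank (K :&: Bd) = \rank Bd by rewrite (capmx_idPr sBK).
  by rewrite mxrank_ker => <-; rewrite addKn.
have cyc v : (v <= K)%MS -> kcycle I i.+1 j (@lift_row i.+1 j v).
  move=> /sub_kermxP hv; split; first exact: lift_row_in.
  apply/(@in_I_coords i j); first by apply/kdiff_in/lift_row_in.
  by rewrite coords_kdiff ?lift_rowK //; apply: lift_row_in.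
have bdry c : chain_in i.+1 j c ->
    (kbdry I i.+1 j c <-> (coords i.+1 j c <= Bd)%MS).
  move=> hc; split.
    case=> _ [b [hb]] /(@in_I_coords i.+1 j) h.
    move: (h (chain_in_sub hc (kdiff_in hb))); rewrite linearB /=.
    move/eqP; rewrite subr_eq0 => /eqP ->; rewrite coords_kdiff //.
    exact: submxMl.
  case/submxP => w hw; split=> //; exists (lift_row w); split; first exact: lift_row_in.
  apply/(@in_I_coords i.+1 j).
    by apply/chain_in_sub => //; apply/kdiff_in/lift_row_in.
  by rewrite linearB /= coords_kdiff ?lift_rowK ?hw ?subrr //; apply: lift_row_in.
rewrite -rQ; pose z l := @lift_row i.+1 j (row l (row_base Q)).
have lin a : lincomb a z = lift_row ((\row_l a l) *m row_base Q).
  rewrite mulmx_sum_row linear_sum; apply/ffunP => A; rewrite ffunE sum_ffunE.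
  by apply: eq_bigr => l _; rewrite mxE linearZ [RHS]ffunE.
exists z; split.
- move=> l; apply: cyc; apply: submx_trans (diffmxSl K Bd).
  by rewrite -/Q -(eq_row_base Q) row_sub.
- move=> a; rewrite lin => /bdry -/(_ (lift_row_in _)); rewrite lift_rowK => h.
  have : ((\row_l a l) *m row_base Q <= Q :&: Bd)%MS.
    by rewrite sub_capmx h andbT -(eq_row_base Q) submxMl.
  rewrite capmx_diff submx0 => /eqP /(congr1 (mulmxr (pinvmx (row_base Q)))) /=.
  rewrite mul0mx -mulmxA mulmxVp ?row_base_free // mulmx1 => h0 l.
  by move/rowP: h0 => /(_ l); rewrite !mxE.
- move=> c [hc hd].
  have cK : (coords i.+1 j c <= K)%MS.
    apply/sub_kermxP; rewrite -coords_kdiff //.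
    by apply/(in_I_coords (kdiff_in hc)).
  have : (coords i.+1 j c <= Q + Bd)%MS.
    apply: submx_trans cK _; rewrite -(addsmx_diff_cap_eq K Bd).
    by rewrite addsmxS // capmxSr.
  case/sub_addsmxP => -[u1 u2] /= hu.
  have : (u1 *m Q <= row_base Q)%MS by rewrite eq_row_base submxMl.
  case/submxP => w hw.
  exists (fun l => w 0 l); apply/bdry.
    by rewrite lin; apply: chain_in_sub (lift_row_in _).
  rewrite lin linearB /= lift_rowK hu.
  have -> : \row_l w 0 l = w by apply/rowP => l; rewrite mxE.
  by rewrite -hw addrC addKr submxMl.
Qed.

End TorRank.

(** * A matching on the Koszul complex *)

Section Matching.
Variable N : nat.
(** Read [V m] as the set of non-free variables and [u m] as the generator of the piece containing
    [m], and [key] as the rank of that piece in the order of pieces. *)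
Variables (std : pred 'X_{1..N}) (wt : 'I_N -> nat).
Variables (V : 'X_{1..N} -> {set 'I_N}) (u : 'X_{1..N} -> 'X_{1..N}).
Variables (key : 'X_{1..N} -> nat) (K : nat).

Definition wtm (m : 'X_{1..N}) : nat := (\sum_t m t * wt t)%N.

Hypothesis key_lt : forall m, (key m < K)%N.
Hypothesis u_le : forall m t, std m -> (u m t <= m t)%N.
Hypothesis free_mul : forall m t, std m -> t \notin V m ->
  [/\ std (m + U_(t))%MM, u (m + U_(t))%MM = u m, V (m + U_(t))%MM = V m
    & key (m + U_(t))%MM = key m].
Hypothesis bound_mul : forall m t, std m -> t \in V m ->
  std (m + U_(t))%MM -> (key (m + U_(t))%MM < key m)%N.
Hypothesis free_div : forall m t, std m -> t \notin V m -> (u m t < m t)%N ->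
  [/\ std (m - U_(t))%MM, u (m - U_(t))%MM = u m, V (m - U_(t))%MM = V m
    & key (m - U_(t))%MM = key m].

Lemma wtmD m m' : wtm (m + m') = (wtm m + wtm m')%N.
Proof. by rewrite /wtm -big_split; apply: eq_bigr => t _; rewrite mnmDE mulnDl. Qed.

Lemma wtmU t : wtm U_(t) = wt t.
Proof.
rewrite /wtm (bigD1 t) //= mnm1E eqxx mul1n big1 ?addn0 // => s.
by rewrite mnm1E eq_sym => /negbTE ->.
Qed.

(** The free variables that can move between the exterior factor $e_A$ and the monomial without
    leaving the piece. Moving one of them does not change this set, so its least element is the same
    before and after. *)
Definition tset (A : {set 'I_N}) (m : 'X_{1..N}) : {set 'I_N} :=
  [set t | (t \notin V m) && ((t \in A) || (u m t < m t)%N)].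

Definition pivot_of (T : {set 'I_N}) : option 'I_N :=
  [pick t in T | [forall s in T, (t <= s)%N]].

Lemma pivot_ofP T : match pivot_of T with
  | Some t => t \in T : Prop
  | None => T = set0 end.
Proof.
rewrite /pivot_of; case: pickP => [t /andP[] //|h].
apply/eqP; apply: contraT => /set0Pn [t0 t0T].
have := h [arg min_(t < t0 in T) t]; case: arg_minnP => // t tT tmin.
by rewrite tT => /negbT /forall_inPn [s sT]; rewrite tmin.
Qed.

Section Strand.
Variable j : nat.
Local Notation cellT := ({set 'I_N} * 'X_{1..N < j.+1})%type.

Definition pivot (z : cellT) := pivot_of (tset z.1 z.2).
Definition is_up (z : cellT) : bool := if pivot z is Some t then t \in z.1 else false.
Definition is_crit (z : cellT) : bool := pivot z == None.
Definition is_down (z : cellT) : bool := ~~ is_crit z && ~~ is_up z.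

(** The default of [insubd] is never reached on cells of internal degree $j$: the total degree is
    preserved, so the new monomial still has degree at most $j$. *)
Definition toggle (z : cellT) : cellT :=
  if pivot z is Some t then
    if t \in z.1 then (z.1 :\ t, insubd z.2 (z.2 + U_(t))%MM)
    else (t |: z.1, insubd z.2 (z.2 - U_(t))%MM)
  else z.

Definition wcell (A : {set 'I_N}) (m : 'X_{1..N}) : nat :=
  (\sum_(t in A) wt t + wtm m)%N.

(* [K] bounds [key], so this orders cells by weight first and by [key] second. *)
Definition rkey (z : cellT) : nat := (K * wcell z.1 z.2 + key z.2)%N.

Definition okz (z : cellT) := (#|z.1| + mdeg z.2 == j)%N && std z.2.

Lemma toggle_up z t : okz z -> pivot z = Some t -> t \in z.1 ->
  [/\ (toggle z).1 = z.1 :\ t, (toggle z).2 = (z.2 + U_(t))%MM :> 'X_{1..N},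
      okz (toggle z), pivot (toggle z) = Some t & rkey (toggle z) = rkey z].
Proof.
move=> /andP [/eqP hd hs] hp tA.
have hT : t \in tset z.1 z.2 by have := pivot_ofP (tset z.1 z.2); rewrite -/(pivot z) hp.
have tV : t \notin V z.2 by move: hT; rewrite inE => /andP [].
have [s1 s2 s3 s4] := free_mul hs tV.
have card : #|z.1| = #|z.1 :\ t|.+1 by rewrite (cardsD1 t) tA.
have e2 : (toggle z).2 = (z.2 + U_(t))%MM :> 'X_{1..N}.
  rewrite /toggle hp tA /= val_insubd mdegD mdeg1.
  by rewrite ifT //; lia.
have e1 : (toggle z).1 = z.1 :\ t by rewrite /toggle hp tA.
have eT : tset (z.1 :\ t) (z.2 + U_(t))%MM = tset z.1 z.2.
  apply/setP => s; rewrite !inE s2 s3 mnmDE mnm1E (eq_sym t).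
  case: (eqVneq s t) => [->|_] /=; last by rewrite addn0.
  by rewrite addn1 ltnS u_le // tA.
split => //.
- by rewrite /okz e1 e2 s1 andbT mdegD mdeg1; apply/eqP; lia.
- by rewrite /pivot e1 e2 eT.
- rewrite /rkey e1 e2 s4 /wcell (big_setD1 t tA) wtmD wtmU /=.
  by congr (K * _ + _)%N; rewrite addnA addnC addnA.
Qed.

Lemma toggle_down z t : okz z -> pivot z = Some t -> t \notin z.1 ->
  [/\ (toggle z).1 = t |: z.1, (toggle z).2 = (z.2 - U_(t))%MM :> 'X_{1..N},
      okz (toggle z), pivot (toggle z) = Some t & rkey (toggle z) = rkey z].
Proof.
move=> /andP [/eqP hd hs] hp tA.
have hT : t \in tset z.1 z.2 by have := pivot_ofP (tset z.1 z.2); rewrite -/(pivot z) hp.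
move: (hT); rewrite inE (negbTE tA) /= => /andP [tV ut].
have [s1 s2 s3 s4] := free_div hs tV ut.
have ez : (z.2 - U_(t) + U_(t))%MM = z.2 :> 'X_{1..N}.
  by rewrite submK // lep1mP -lt0n; apply: leq_ltn_trans ut.
have em : mdeg z.2 = (mdeg (z.2 - U_(t))%MM).+1.
  by rewrite -{1}ez mdegD mdeg1 addn1.
have e1 : (toggle z).1 = t |: z.1 by rewrite /toggle hp (negbTE tA).
have e2 : (toggle z).2 = (z.2 - U_(t))%MM :> 'X_{1..N}.
  by rewrite /toggle hp (negbTE tA) /= val_insubd ifT //; lia.
have eT : tset (t |: z.1) (z.2 - U_(t))%MM = tset z.1 z.2.
  apply/setP => s; rewrite !inE s2 s3 mnmBE mnm1E (eq_sym t).
  case: (eqVneq s t) => [->|_] /=; last by rewrite subn0.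
  by rewrite tV ut orbT.
split => //.
- by rewrite /okz e1 e2 s1 andbT cardsU1 tA; apply/eqP; lia.
- by rewrite /pivot e1 e2 eT.
- have -> : rkey z = (K * (\sum_(a in z.1) wt a + (wtm (z.2 - U_(t)) + wt t)) + key z.2)%N.
    by rewrite -wtmU -wtmD ez.
  rewrite /rkey e1 e2 s4 /wcell big_setU1 //=.
  by congr (K * _ + _)%N; rewrite [RHS]addnA [RHS]addnC addnA.
Qed.

Lemma toggleK z : okz z -> toggle (toggle z) = z.
Proof.
move=> hz; case hp: (pivot z) => [t|]; last by rewrite /toggle hp hp.
case: (boolP (t \in z.1)) => tA.
  have [e1 e2 ok' hp' _] := toggle_up hz hp tA.
  have tA' : t \notin (toggle z).1 by rewrite e1 !inE eqxx.
  have [f1 f2 _ _ _] := toggle_down ok' hp' tA'.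
  apply/eqP; rewrite -pair_eqE /pair_eq /= f1 e1 setD1K // eqxx /=.
  by rewrite -val_eqE /= f2 e2 addmK.
have [e1 e2 ok' hp' _] := toggle_down hz hp tA.
have tA' : t \in (toggle z).1 by rewrite e1 !inE eqxx.
have [f1 f2 _ _ _] := toggle_up ok' hp' tA'.
apply/eqP; rewrite -pair_eqE /pair_eq /= f1 e1 setU1K // eqxx /=.
rewrite -val_eqE /= f2 e2 submK // lep1mP -lt0n.
have := pivot_ofP (tset z.1 z.2); rewrite -/(pivot z) hp inE (negbTE tA) /=.
by case/andP => _; apply: leq_ltn_trans.
Qed.

Lemma mem_cells i (z : cellT) : (z \in cells std i j) = (#|z.1| == i) && okz z.
Proof. by rewrite inE. Qed.

Definition ups i := [set z in cells std i j | is_up z].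
Definition downs i := [set z in cells std i j | is_down z].
Definition crits i := [set z in cells std i j | is_crit z].

Lemma card_cells i : #|cells std i j| = (#|ups i| + #|downs i| + #|crits i|)%N.
Proof.
rewrite -(cardsID [set z | is_crit z]) addnC; congr (_ + _)%N; last first.
  by apply: eq_card => z; rewrite !inE.
rewrite -(cardsID [set z | is_up z]); congr (_ + _)%N.
  apply: eq_card => z; rewrite !inE /is_crit /is_up; case: (pivot z) => [t|] /=;
    by rewrite ?andbT ?andbF.
by apply: eq_card => z; rewrite !inE /is_down; case: (is_up z); case: (is_crit z);
  rewrite ?andbF ?andbT.
Qed.

Lemma ups_toggle i z : z \in ups i.+1 -> toggle z \in downs i.
Proof.
rewrite inE mem_cells /is_up => /andP [/andP [/eqP card ok]].
case hp: (pivot z) => [t|] // tA.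
have [e1 _ ok' hp' _] := toggle_up ok hp tA.
rewrite inE mem_cells ok' /is_down /is_crit /is_up hp' /= e1 !inE eqxx !andbT.
by move: card; rewrite (cardsD1 t) tA => -[/eqP].
Qed.

Lemma downs_toggle i z : z \in downs i -> toggle z \in ups i.+1.
Proof.
rewrite inE mem_cells /is_down /is_crit /is_up => /andP [/andP [/eqP card ok]].
case hp: (pivot z) => [t|] //= tA.
have [e1 _ ok' hp' _] := toggle_down ok hp tA.
by rewrite inE mem_cells ok' /is_up hp' /= e1 !inE eqxx cardsU1 tA card !andbT.
Qed.

(** Toggling is an involution that exchanges the two sets. *)
Lemma card_ups i : #|ups i.+1| = #|downs i|.
Proof.
apply/eqP; rewrite eqn_leq; apply/andP; split.
  rewrite -(card_in_imset (f := toggle)).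
    by apply/subset_leq_card/subsetP => _ /imsetP [z hz ->]; apply: ups_toggle.
  apply: (can_in_inj (g := toggle)) => z; rewrite inE mem_cells => /andP [/andP [_ ok] _].
  exact: toggleK.
rewrite -(card_in_imset (f := toggle)).
  by apply/subset_leq_card/subsetP => _ /imsetP [z hz ->]; apply: downs_toggle.
apply: (can_in_inj (g := toggle)) => z; rewrite inE mem_cells => /andP [/andP [_ ok] _].
exact: toggleK.
Qed.

(** * Triangularity of the differential along the matching *)

Section Rank.
Variables (k : fieldType) (nfm : 'X_{1..N} -> option 'X_{1..N}).
Hypothesis nfm_std : forall m, std m -> nfm m = Some m.
Hypothesis nfm_some : forall m m', nfm m = Some m' -> std m' /\ mdeg m' = mdeg m.
Hypothesis nfm_lt : forall m m', nfm m = Some m' -> ~~ std m -> (wtm m' < wtm m)%N.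
Local Notation nf := (@nf k N nfm).
Local Notation kd A m := (kdiff (@ebas k N A m)).

Lemma kdiff_ebasE (A B : {set 'I_N}) (m : 'X_{1..N}) : kd A m B =
  \sum_(t | (t \notin B) && (t |: B == A))
     (-1) ^+ #|[set s in B | (s < t)%N]| *: 'X_[m + U_(t)].
Proof.
rewrite kdiffE big_mkcondr /=; apply: eq_bigr => t _; rewrite ffunE.
case: ifP => _; last by rewrite mulr0.
by rewrite -mulrA signZ -mpolyXD addmC.
Qed.

Lemma kdiff_ebas_neq0 (A B : {set 'I_N}) m m' : (nf (kd A m B))@_m' != 0 ->
  exists t, [/\ t \notin B, t |: B = A & nfm (m + U_(t)) = Some m'].
Proof.
rewrite kdiff_ebasE nf_sum raddf_sum /= => h.
have [t /andP [tB /eqP eA]] : exists2 t, (t \notin B) && (t |: B == A) &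
    (nf ((-1) ^+ #|[set s in B | (s < t)%N]| *: 'X_[m + U_(t)]))@_m' != 0.
  apply/exists_inP; apply: contraR h; rewrite negb_exists_in => /forall_inP h.
  by rewrite big1 // => t /h; rewrite negbK => /eqP.
rewrite nfZ mcoeffZ /nf linextX mulf_eq0 negb_or => /andP [_].
case E: (nfm _) => [m1|] /=; last by rewrite mcoeff0 eqxx.
rewrite mcoeffX; case: (m1 =P m') => [<- _|_]; last by rewrite eqxx.
by exists t.
Qed.

(** Only the removal of $t$ leads from $A$ to $A\setminus t$, so the coefficient is a sign. *)
Lemma kdiff_ebas_pivot (A : {set 'I_N}) m t : t \in A -> std (m + U_(t))%MM ->
  (nf (kd A m (A :\ t)))@_(m + U_(t)) != 0.
Proof.
move=> tA hs; rewrite kdiff_ebasE (big_pred1 t).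
  by rewrite nfZ mcoeffZ /nf linextX nfm_std //= mcoeffX eqxx mulr1 signr_eq0.
move=> s /=; rewrite !inE; case: (eqVneq s t) => [->|h] /=.
  by rewrite setD1K // eqxx.
by apply/negbTE; apply: contraL tA => /andP [_ /eqP <-]; rewrite !inE eqxx eq_sym (negbTE h).
Qed.

Lemma rkey_lt (x z : cellT) :
  (wcell z.1 z.2 < wcell x.1 x.2)%N -> (rkey z < rkey x)%N.
Proof.
move=> h; have hz := key_lt z.2; rewrite /rkey.
have : (K * (wcell z.1 z.2).+1 <= K * wcell x.1 x.2)%N by rewrite leq_mul2l h orbT.
by rewrite mulnS; lia.
Qed.

(** Let $x_r$ be the variable moved by the differential. If the product is nonstandard, reduction
    lowers the weight. If it is standard and $r$ is not free, the weight stays and the key drops. If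
    $r$ is free, then [x] and [z] have the same partner, contrary to [x != z]. *)
Lemma kdiff_toggle i x z : x \in ups i.+1 -> z \in ups i.+1 -> x != z ->
  (nf (kd x.1 x.2 (toggle z).1))@_((toggle z).2) != 0 -> (rkey z < rkey x)%N.
Proof.
rewrite !inE /is_up; case/andP => /and3P [cx dx sx]; case px: (pivot x) => [t|] // tx.
case/andP => /and3P [cz dz sz]; case pz: (pivot z) => [s|] // sz1 xz.
have okx : okz x by rewrite /okz dx.
have okzz : okz z by rewrite /okz dz.
have [e1 e2 ok' hp' <-] := toggle_up okzz pz sz1.
case/kdiff_ebas_neq0 => r [rB eA hn].
have wA : (\sum_(a in x.1) wt a = wt r + \sum_(a in (toggle z).1) wt a)%N.
  by rewrite -eA big_setU1.
case: (boolP (std (x.2 + U_(r))%MM)) => hs; last first.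
  have := nfm_lt hn hs; rewrite wtmD wtmU => hw.
  apply: rkey_lt; rewrite /wcell wA (addnC (wt r)) -addnA ltn_add2l.
  by rewrite addnC.
move: hn; rewrite nfm_std // => -[e].
case: (boolP (r \in V x.2)) => rV.
  have := bound_mul sx rV hs; rewrite /rkey /wcell wA -e wtmD wtmU.
  by rewrite (addnC (wt r)) -[in X in _ -> (_ < X)%N]addnA (addnC (wt r)) ltn_add2l.
have [s1 s2 s3 s4] := free_mul sx rV.
case/eqP: xz; suff -> : x = toggle (toggle z) by rewrite toggleK.
(* Both cells have the same [tset], hence the same pivot. It lies in [x.1] but not in
   [(toggle z).1], and these sets differ only by $r$. *)
have rt : t = r.
  have eT : tset (toggle z).1 (toggle z).2 = tset x.1 x.2.
    apply/setP => a; rewrite -eA -e !inE s2 s3 mnmDE mnm1E (eq_sym r).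
    case: (eqVneq a r) => [->|_] /=; last by rewrite addn0.
    by rewrite addn1 ltnS u_le // orbT rV.
  have : pivot x = Some s by rewrite -hp' /pivot eT.
  rewrite px => -[ts]; apply/eqP; apply: contraLR tx => tr.
  by rewrite -eA !inE (negbTE tr) /= ts e1 !inE eqxx.
have ex : toggle x = toggle z.
  have [f1 f2 _ _ _] := toggle_up okx px tx.
  apply/eqP; rewrite -pair_eqE /pair_eq /= f1 -eA rt setU1K // eqxx /=.
  by rewrite -val_eqE /= f2 -e rt.
by rewrite -ex toggleK.
Qed.

(** The rows of the up cells are independent, because their matrix on the columns of the partners is
    triangular for [rkey] with nonzero diagonal. *)
Lemma rank_ge_ups i : (#|ups i.+1| <= \rank (dmx k std nfm i j))%N.
Proof.
have mem (z : 'I_#|ups i.+1|) : enum_val z \in cells std i.+1 j.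
  by have := enum_valP z; rewrite inE => /andP [].
pose f (l : 'I_#|ups i.+1|) : 'I_#|cells std i.+1 j| :=
  enum_rank_in (mem l) (enum_val l).
have fE l : cell (f l) = enum_val l by rewrite /cell enum_rankK_in.
set D := dmx k std nfm i j.
suff h : row_free (rowsub f D).
  by rewrite -{1}(eqP h) mxrankS // rowsub_sub.
apply: inj_row_free => v hv; apply/eqP; apply: contraT => /rV0Pn [a0 ha0].
pose c (l : 'I_#|ups i.+1|) : cellT := enum_val l.
have cP l : c l \in ups i.+1 by apply: enum_valP.
(* In a vanishing combination pick a row of largest [rkey]; no other row with nonzero coefficient
   meets the column of its partner. *)
have [a ha amax] := @arg_maxnP _ _ (fun l => v 0 l != 0) (fun l => rkey (c l)) ha0.
have tm : toggle (c a) \in cells std i j.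
  by have := ups_toggle (cP a); rewrite inE => /andP [].
move/rowP: hv => /(_ (enum_rank_in tm (toggle (c a)))).
rewrite !mxE (bigD1 a) //= big1 ?addr0.
  rewrite !mxE fE /cell enum_rankK_in // => /eqP; rewrite mulf_eq0 (negbTE ha) /=.
  have := cP a; rewrite inE mem_cells /is_up => /andP [/andP [_ ok]].
  case hp: (pivot _) => [t|] // tA.
  have [e1 e2 ok' _ _] := toggle_up ok hp tA.
  apply: contraTeq => _; rewrite e1 e2 kdiff_ebas_pivot // -e2.
  by case/andP: ok'.
move=> b hb; rewrite !mxE fE /cell enum_rankK_in //.
have [->|vb] := eqVneq (v 0 b) 0; first by rewrite mul0r.
apply/eqP; rewrite mulf_eq0 (negbTE vb) /=; apply: contraT => hn.
have := kdiff_toggle (cP b) (cP a) _ hn; rewrite (inj_eq enum_val_inj) => /(_ hb).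
by rewrite ltnNge (amax b vb : (_ <= _)%N).
Qed.

Section TorCrit.
Variable I : {mpoly k[N]} -> Prop.
Hypothesis I_nf : forall f, I f <-> nf f = 0.
Hypothesis I_mulX : forall f t, I f -> I ('X_t * f).

Lemma rank_dmx_le i :
  (\rank (dmx k std nfm i j) + \rank (dmx k std nfm i.+1 j) <= #|cells std i.+1 j|)%N.
Proof.
have h := dmx_mul nfm_std nfm_some I_nf I_mulX i j.
have := mulmx0_rank_max h; lia.
Qed.

(** Without critical cells the up and down cells exhaust the basis, and the lower bounds for the
    outgoing and incoming ranks already add up to its size. *)
Lemma tor_dim_crit0 i : #|crits i.+1| = 0%N -> tor_dim I i.+1 j 0.
Proof.
move=> h; have := tor_dim_rank nfm_std nfm_some I_nf I_mulX i j.
have h1 := rank_ge_ups i; have h2 := rank_ge_ups i.+1.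
have h3 := card_cells i.+1; have h4 := card_ups i.+1.
by have -> : (#|cells std i.+1 j| - \rank (dmx k std nfm i j)
            - \rank (dmx k std nfm i.+1 j) = 0)%N by lia.
Qed.

(* [rank_ge_ups] bounds all ranks from below; the absence of critical cells in the
   two neighbouring degrees turns these bounds into equalities. *)
Lemma tor_dim_crit i : #|crits i.+1| = 0%N -> #|crits i.+3| = 0%N ->
  tor_dim I i.+2 j #|crits i.+2|.
Proof.
move=> ha hb; have := tor_dim_rank nfm_std nfm_some I_nf I_mulX i.+1 j.
have h1 := rank_ge_ups i; have h2 := rank_ge_ups i.+1.
have h3 := rank_ge_ups i.+2; have h4 := rank_ge_ups i.+3.
have g1 := rank_dmx_le i; have g2 := rank_dmx_le i.+2.
have c1 := card_cells i.+1; have c2 := card_cells i.+2; have c3 := card_cells i.+3.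
have d1 := card_ups i.+1; have d2 := card_ups i.+2; have d3 := card_ups i.+3.
by have -> : (#|cells std i.+2 j| - \rank (dmx k std nfm i.+1 j)
            - \rank (dmx k std nfm i.+2 j) = #|crits i.+2|)%N by lia.
Qed.

End TorCrit.
End Rank.

End Strand.
End Matching.

(** * Initial ideals of closed graphs *)

Section Lex.
Variable N : nat.
Implicit Types a b c : 'X_{1..N}.

Lemma ltlexP a b : reflect (exists2 t : 'I_N, (a t < b t)%N &
    forall s : 'I_N, (s < t)%N -> a s = b s) (ltlex a b).
Proof.
apply: (iffP existsP) => [[t /andP [h /forallP hs]]|[t h hs]]; exists t => //.
  by move=> s /(implyP (hs s)) /eqP.
by rewrite h; apply/forallP => s; apply/implyP => /hs ->.
Qed.

Lemma ltlex_trans b a c : ltlex a b -> ltlex b c -> ltlex a c.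
Proof.
case/ltlexP => t ht hs /ltlexP [t' ht' hs']; apply/ltlexP.
case: (ltngtP t t') => [h|h|/val_inj h].
- exists t; first by rewrite -hs'.
  by move=> s st; rewrite hs // hs' //; apply: ltn_trans h.
- exists t'; first by rewrite hs.
  by move=> s st; rewrite hs ?hs' //; apply: ltn_trans h.
- by exists t; [rewrite h in ht *; apply: ltn_trans ht' | move=> s st; rewrite hs ?hs' -?h].
Qed.

Lemma ltlex_irr a : ~~ ltlex a a.
Proof. by apply/ltlexP => -[t]; rewrite ltnn. Qed.

End Lex.

(** * Confluent rewriting along the edges *)

Section Rewriting.
Variables (n : nat) (G : rel 'I_n).
Hypothesis Gsimple : simple_graph G.
Hypothesis Gclosed : closed_graph G.
Local Notation mono := 'X_{1..n + n}.
Local Notation X i := (U_(lshift n i))%MM.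
Local Notation Y i := (U_(rshift n i))%MM.

Definition redex (m : mono) (i j : 'I_n) : bool :=
  [&& (i < j)%N, G i j, (0 < m (lshift n i))%N & (0 < m (rshift n j))%N].

Definition stdm (m : mono) : bool := [forall i, forall j, ~~ redex m i j].

Definition swap (i j : 'I_n) (m : mono) : mono := (m - (X i + Y j) + (X j + Y i))%MM.

(** Weight $j$ for $y_j$ and $0$ for every $x_i$: a swap replaces $y_j$ by $y_i$ with $i<j$, so the
    weight bounds the number of rewriting steps and serves as fuel in [nfJ]. *)
Definition ywt (t : 'I_(n + n)) : nat := if split t is inr j then j else 0.

Lemma ywt_l i : ywt (lshift n i) = 0%N.
Proof. by rewrite /ywt (unsplitK (inl i)). Qed.

Lemma ywt_r i : ywt (rshift n i) = i.
Proof. by rewrite /ywt (unsplitK (inr i)). Qed.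

Lemma swapE i j p : swap i j (p + (X i + Y j)) = (p + (X j + Y i))%MM.
Proof. by rewrite /swap addmK. Qed.

Lemma xvar_l (i j : 'I_n) : (X i : mono) (lshift n j) = (i == j).
Proof. by rewrite mnm1E (inj_eq (@lshift_inj _ _)). Qed.
Lemma yvar_r (i j : 'I_n) : (Y i : mono) (rshift n j) = (i == j).
Proof. by rewrite mnm1E (inj_eq (@rshift_inj _ _)). Qed.
Lemma xvar_r (i j : 'I_n) : (X i : mono) (rshift n j) = 0%N.
Proof. by rewrite mnm1E eq_lrshift. Qed.
Lemma yvar_l (i j : 'I_n) : (Y i : mono) (lshift n j) = 0%N.
Proof. by rewrite mnm1E eq_rlshift. Qed.

Lemma split_X i (m : mono) : (0 < m (lshift n i))%N -> exists p : mono, m = (p + X i)%MM.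
Proof.
by move=> h; exists (m - X i)%MM; rewrite submK // lep1mP -lt0n.
Qed.

Lemma split_Y i (m : mono) : (0 < m (rshift n i))%N -> exists p : mono, m = (p + Y i)%MM.
Proof.
by move=> h; exists (m - Y i)%MM; rewrite submK // lep1mP -lt0n.
Qed.

Lemma split_redex m i j : redex m i j ->
  [/\ (i < j)%N, G i j & exists p : mono, m = (p + (X i + Y j))%MM].
Proof.
case/and4P => ij gij /split_X [q ->]; rewrite mnmDE xvar_r addn0 => /split_Y [p ->].
by split=> //; exists p; apply/mnmP => t; rewrite !mnmDE; lia.
Qed.

Lemma redex_intro p (i j : 'I_n) : (i < j)%N -> G i j -> redex (p + (X i + Y j)) i j.
Proof.
move=> ij gij; rewrite /redex ij gij !mnmDE xvar_l yvar_l xvar_r yvar_r !eqxx.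
by apply/andP; split; lia.
Qed.

Lemma swap_wt m i j : redex m i j -> (wtm ywt (swap i j m) < wtm ywt m)%N.
Proof.
move=> /split_redex [ij _ [p ->]]; rewrite swapE !wtmD !wtmU !ywt_l !ywt_r.
by rewrite !add0n ltn_add2l.
Qed.

Lemma swap_deg m i j : redex m i j -> mdeg (swap i j m) = mdeg m.
Proof. by move=> /split_redex [_ _ [p ->]]; rewrite swapE !mdegD !mdeg1. Qed.

Lemma ltlex_binomial p (i j : 'I_n) : (i < j)%N ->
  ltlex (p + (X j + Y i)) (p + (X i + Y j)).
Proof.
move=> ij; apply/ltlexP; exists (lshift n i).
  by rewrite !mnmDE !xvar_l !yvar_l eqxx; case: eqP ij => [->|_ _]; rewrite ?ltnn //; lia.
move=> s /= si; have sn : (s < n)%N by apply: ltn_trans si _.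
have -> : s = lshift n (Ordinal sn) by apply: val_inj.
rewrite !mnmDE !xvar_l !yvar_l -!val_eqE /=.
by have [-> ->] : (i == s :> nat) = false /\ (j == s :> nat) = false by lia.
Qed.

Lemma swap_lex m i j : redex m i j -> ltlex (swap i j m) m.
Proof. by move=> /split_redex [ij _ [p ->]]; rewrite swapE ltlex_binomial. Qed.

Definition pick_redex (m : mono) : option ('I_n * 'I_n) :=
  [pick e : 'I_n * 'I_n | redex m e.1 e.2].

Fixpoint reduce (d : nat) (m : mono) : mono :=
  if d is d'.+1 then
    if pick_redex m is Some e then reduce d' (swap e.1 e.2 m) else m
  else m.

Definition nfJ (m : mono) : mono := reduce (wtm ywt m) m.

Lemma reduce_fuel d m : (wtm ywt m <= d)%N -> reduce d m = nfJ m.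
Proof.
suff h : forall d d' m, (wtm ywt m <= d)%N -> (wtm ywt m <= d')%N ->
    reduce d m = reduce d' m by move=> hd; apply: h.
move=> {d m}; elim=> [|d IH] [|d'] m h1 h2 //=; rewrite /pick_redex;
  case: pickP => // -[i j] /= /swap_wt => h; try by exfalso; lia.
by apply: IH; lia.
Qed.

Lemma pick_redexP m : match pick_redex m with
  | Some e => redex m e.1 e.2 : Prop | None => stdm m end.
Proof.
rewrite /pick_redex; case: pickP => // h; apply/forallP => i; apply/forallP => j.
by rewrite (h (i, j)).
Qed.

Lemma nfJ_pick m e : pick_redex m = Some e -> nfJ m = nfJ (swap e.1 e.2 m).
Proof.
move=> he; have := pick_redexP m; rewrite he => /swap_wt h.
rewrite -(@reduce_fuel (wtm ywt m).-1 (swap e.1 e.2 m)); last by lia.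
by rewrite {1}/nfJ; case: (wtm ywt m) h => //= d _; rewrite he.
Qed.

Lemma nfJ_std m : stdm m -> nfJ m = m.
Proof.
move=> h; rewrite /nfJ; case: (wtm ywt m) => //= d.
have := pick_redexP m; case: pick_redex => // e /=.
by move/forallP: h => /(_ e.1) /forallP /(_ e.2) /negbTE ->.
Qed.

(* The rewriting is locally confluent: two overlapping redexes share their x- or
   their y-variable, and closedness supplies the edge that joins the results. *)
Lemma nfJ_swap m i j : redex m i j -> nfJ m = nfJ (swap i j m).
Proof.
have [d] := ubnP (wtm ywt m); elim: d m i j => // d IH m i j /ltnSE hd rij.
have := pick_redexP m; case E: (pick_redex m) => [[a b]|] /=; last first.
  by move/forallP => /(_ i) /forallP /(_ j); rewrite rij.
move=> rab; rewrite (nfJ_pick E) /=.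
have step m' i' j' : (wtm ywt m' < wtm ywt m)%N -> redex m' i' j' ->
    nfJ m' = nfJ (swap i' j' m').
  by move=> h; apply: IH; lia.
have w1 := swap_wt rab; have w2 := swap_wt rij.
have [lij gij [p ep]] := split_redex rij.
have [lab gab _] := split_redex rab.
have [_ sym] := Gsimple.
case: (eqVneq i a) => [eia|nia]; last case: (eqVneq j b) => [ejb|njb].
- subst a; case: (eqVneq j b) => [->|njb] //.
  have [q eq] : exists q : mono, p = (q + Y b)%MM.
    apply: split_Y; case/and4P: rab => _ _ _.
    by rewrite ep !mnmDE xvar_r yvar_r (negbTE njb) !addn0.
  subst p.
  have m1 : swap i j m = (q + Y i + (X j + Y b))%MM.
    by rewrite ep swapE; apply/mnmP => t; rewrite !mnmDE; lia.
  have m2 : swap i b m = (q + Y i + (X b + Y j))%MM.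
    have -> : m = (q + Y j + (X i + Y b))%MM.
      by rewrite ep; apply/mnmP => t; rewrite !mnmDE; lia.
    by rewrite swapE; apply/mnmP => t; rewrite !mnmDE; lia.
  have gjb : G j b by apply: Gclosed gij gab njb _; rewrite lij lab.
  case: (ltngtP j b) => [h|h|/val_inj h]; last by rewrite h eqxx in njb.
    have r : redex (swap i j m) j b by rewrite m1 redex_intro.
    by rewrite (step _ _ _ w2 r) m1 swapE -m2.
  have r : redex (swap i b m) b j by rewrite m2 redex_intro // sym.
  by rewrite (step _ _ _ w1 r) m2 swapE -m1.
- subst b.
  have [q eq] : exists q : mono, p = (q + X a)%MM.
    apply: split_X; case/and4P: rab => _ _.
    by rewrite ep !mnmDE xvar_l yvar_l (negbTE nia) !addn0.
  subst p.
  have m1 : swap i j m = (q + X j + (X a + Y i))%MM.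
    by rewrite ep swapE; apply/mnmP => t; rewrite !mnmDE; lia.
  have m2 : swap a j m = (q + X j + (X i + Y a))%MM.
    have -> : m = (q + X i + (X a + Y j))%MM.
      by rewrite ep; apply/mnmP => t; rewrite !mnmDE; lia.
    by rewrite swapE; apply/mnmP => t; rewrite !mnmDE; lia.
  have gia : G i a.
    have gji : G j i by rewrite sym.
    have gja : G j a by rewrite sym.
    by apply: Gclosed gji gja nia _; rewrite lij lab orbT.
  case: (ltngtP i a) => [h|h|/val_inj h]; last by rewrite h eqxx in nia.
    have r : redex (swap a j m) i a by rewrite m2 redex_intro.
    by rewrite (step _ _ _ w1 r) m2 swapE -m1.
  have r : redex (swap i j m) a i by rewrite m1 redex_intro // sym.
  by rewrite (step _ _ _ w2 r) m1 swapE -m2.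
(* Redexes without a common variable commute. *)
- have [q eq] : exists q : mono, p = (q + (X a + Y b))%MM.
    have [_ _ ma mb] := and4P rab.
    have [q1 e1] : exists q : mono, p = (q + X a)%MM.
      by apply: split_X; move: ma; rewrite ep !mnmDE xvar_l yvar_l (negbTE nia) !addn0.
    have [q2 e2] : exists q : mono, q1 = (q + Y b)%MM.
      by apply: split_Y; move: mb; rewrite ep e1 !mnmDE !xvar_r yvar_r (negbTE njb) !addn0.
    by exists q2; rewrite e1 e2; apply/mnmP => t; rewrite !mnmDE; lia.
  subst p.
  have m1 : swap i j m = (q + (X j + Y i) + (X a + Y b))%MM.
    by rewrite ep swapE; apply/mnmP => t; rewrite !mnmDE; lia.
  have m2 : swap a b m = (q + (X b + Y a) + (X i + Y j))%MM.
    have -> : m = (q + (X i + Y j) + (X a + Y b))%MM.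
      by rewrite ep; apply/mnmP => t; rewrite !mnmDE; lia.
    by rewrite swapE; apply/mnmP => t; rewrite !mnmDE; lia.
  have r1 : redex (swap i j m) a b by rewrite m1 redex_intro.
  have r2 : redex (swap a b m) i j by rewrite m2 redex_intro.
  rewrite (step _ _ _ w1 r2) (step _ _ _ w2 r1) m1 m2 !swapE.
  by congr nfJ; apply/mnmP => t; rewrite !mnmDE; lia.
Qed.

Lemma nfJ_ind (P : mono -> mono -> Prop) :
  (forall m, stdm m -> P m m) ->
  (forall m i j, redex m i j -> P (swap i j m) (nfJ m) -> P m (nfJ m)) ->
  forall m, P m (nfJ m).
Proof.
move=> h0 h1 m; have [d] := ubnP (wtm ywt m); elim: d m => // d IH m /ltnSE hd.
have := pick_redexP m; case E: (pick_redex m) => [[a b]|] /= h.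
  apply: h1 (h) _; rewrite (nfJ_swap h); apply: IH; have := swap_wt h; lia.
by rewrite nfJ_std //; apply: h0.
Qed.

Lemma nfJ_spec m : stdm (nfJ m) /\ mdeg (nfJ m) = mdeg m.
Proof.
apply: (nfJ_ind (P := fun m m' => stdm m' /\ mdeg m' = mdeg m)) => // {}m i j r [hs hd].
by split=> //; rewrite hd swap_deg.
Qed.

Lemma nfJ_lt m : ~~ stdm m -> (wtm ywt (nfJ m) < wtm ywt m)%N /\ ltlex (nfJ m) m.
Proof.
have : nfJ m = m \/ (wtm ywt (nfJ m) < wtm ywt m)%N /\ ltlex (nfJ m) m.
  apply: (nfJ_ind (P := fun m m' => m' = m \/ (wtm ywt m' < wtm ywt m)%N /\ ltlex m' m)).
    by left.
  move=> {}m i j r; have hw := swap_wt r; have hl := swap_lex r.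
  case=> [->|[h1 h2]]; right=> //; split; last exact: ltlex_trans hl.
  exact: ltn_trans hw.
case=> // e; move: (nfJ_spec m) => [+ _]; rewrite e => -> //.
Qed.

(** * Membership in the edge ideal and in its initial ideal *)

Section Ideals.
Variable k : fieldType.
Local Notation poly := {mpoly k[n + n]}.
Local Notation J := (@binom_edge_ideal k n G).
Local Notation nfj := (@nf k (n + n) (fun m => Some (nfJ m))).
Local Notation xk := (@xv k n).
Local Notation yk := (@yv k n).

Definition nfin (m : mono) : option mono := if stdm m then Some m else None.

Lemma edge_ideal0 : J 0.
Proof.
exists (fun _ _ => 0); rewrite big1 // => i _; rewrite big1 // => j _.
by rewrite mul0r.
Qed.

Lemma edge_idealD f g : J f -> J g -> J (f + g).
Proof.
case=> a -> [b ->]; exists (fun i j => a i j + b i j).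
rewrite -big_split; apply: eq_bigr => i _; rewrite -big_split; apply: eq_bigr => j _.
by rewrite mulrDl.
Qed.

Lemma edge_idealM f g : J g -> J (f * g).
Proof.
case=> a ->; exists (fun i j => f * a i j).
rewrite mulr_sumr; apply: eq_bigr => i _; rewrite mulr_sumr; apply: eq_bigr => j _.
by rewrite mulrA.
Qed.

Lemma edge_ideal_gen (i j : 'I_n) : (i < j)%N -> G i j -> J (xk i * yk j - xk j * yk i).
Proof.
move=> ij gij; exists (fun a b => ((a == i) && (b == j))%:R).
rewrite (bigD1 i) //= -[LHS]addr0; congr (_ + _); last first.
  by rewrite big1 // => a /negbTE ->; rewrite big1 // => b _; rewrite mul0r.
rewrite (bigD1 j) ?ij //= !eqxx mul1r big1 ?addr0 // => b /andP [_ /negbTE ->].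
by rewrite andbF mul0r.
Qed.

Lemma binomialX m (i j : 'I_n) :
  'X_[m] * (xk i * yk j - xk j * yk i) = 'X_[m + (X i + Y j)] - 'X_[m + (X j + Y i)] :> poly.
Proof. by rewrite !mpolyXD mulrBr. Qed.

Lemma edge_ideal_sub_nfJ m : J ('X_[m] - 'X_[nfJ m]).
Proof.
apply: (nfJ_ind (P := fun m m' => J ('X_[m] - 'X_[m']))).
  by move=> {}m _; rewrite subrr; apply: edge_ideal0.
move=> {}m i j r h; rewrite -['X_[m]](subrK 'X_[swap i j m]) -addrA.
apply: edge_idealD h; have [lij gij [p ->]] := split_redex r.
by rewrite swapE -binomialX; apply/edge_idealM/edge_ideal_gen.
Qed.

(** By confluence the two terms of a monomial multiple of a generator have the same normal form.
    Conversely $f$ minus its normal form is a combination of differences ['X_[m] - 'X_[nfJ m]],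
    which lie in $J$. *)
Lemma edge_ideal_nf f : J f <-> nfj f = 0.
Proof.
split=> [[a ->]|h].
  rewrite nf_sum big1 // => i _; rewrite nf_sum big1 // => j /andP [ij gij].
  rewrite [a i j]mpolyE mulr_suml nf_sum big1 // => m _.
  rewrite -scalerAl nfZ binomialX /nf linearB /= !linextX /=.
  have r := redex_intro m ij gij.
  by rewrite (nfJ_swap r) swapE subrr scaler0.
rewrite -[f]subr0 -h {1}[f]mpolyE /nf /linext -sumrB.
apply: (big_ind J) => [||m _]; [exact: edge_ideal0|exact: edge_idealD|].
by rewrite -scalerBr -mul_mpolyC; apply/edge_idealM/edge_ideal_sub_nfJ.
Qed.

(** A standard leading monomial would survive in the normal form with its coefficient: rewriting
    makes monomials lexicographically smaller, so no other term of $f$ can reduce to it. This is the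
    Groebner basis property. *)
Lemma edge_ideal_lead f m : J f -> is_lead f m -> ~~ stdm m.
Proof.
move=> /edge_ideal_nf hf [hm hlt]; apply/negP => hs.
have : (nfj f)@_m = f@_m.
  rewrite /nf /linext raddf_sum /= (bigD1_seq m) ?msupp_uniq //=.
  rewrite mcoeffZ nfJ_std // mcoeffX eqxx mulr1 big1_seq ?addr0 // => m' /andP [ne hm'].
  rewrite mcoeffZ mcoeffX; case: eqP => [e|_]; last by rewrite mulr0.
  have ns : ~~ stdm m' by apply: contra ne => hs'; rewrite -e nfJ_std.
  have [_] := nfJ_lt ns; rewrite e => h1.
  by have := ltlex_trans h1 (hlt _ hm' ne); rewrite (negbTE (ltlex_irr _)).
by rewrite hf mcoeff0 => /esym /eqP; rewrite mcoeff_eq0 hm.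
Qed.

Lemma stdm_addl m m' : stdm (m + m')%MM -> stdm m'.
Proof.
move=> /forallP h; apply/forallP => i; apply/forallP => j.
move/forallP: (h i) => /(_ j); apply: contra => /and4P [h1 h2 h3 h4].
by rewrite /redex h1 h2 !mnmDE !addn_gt0 h3 h4 !orbT.
Qed.

Lemma nfin_coeff f m : (@nf k _ nfin f)@_m = if stdm m then f@_m else 0.
Proof.
rewrite {2}[f]mpolyE /nf /linext !raddf_sum /=; case: ifP => hs.
  apply: eq_bigr => m' _; rewrite !mcoeffZ /nfin; case: ifP => //= hs'.
  rewrite mcoeff0 mcoeffX; case: eqP => // e.
  by rewrite e hs in hs'.
rewrite big1 // => m' _; rewrite mcoeffZ /nfin; case: ifP => hs' /=.
  rewrite mcoeffX; case: eqP => [e|_]; last by rewrite mulr0.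
  by rewrite -e hs' in hs.
by rewrite mcoeff0 mulr0.
Qed.

(** Leading monomials of $J$ are nonstandard, and so are their multiples. Conversely each
    nonstandard monomial is a multiple of the leading monomial $x_iy_j$ of a generator. *)
Lemma initial_ideal_nf f : initial_ideal J f <-> @nf k _ nfin f = 0.
Proof.
split.
  case=> r [q [g [lm [hg ->]]]]; rewrite nf_sum big1 // => l _.
  have [Jg _ lg] := hg l; have ns := edge_ideal_lead Jg lg.
  apply/mpolyP => m; rewrite nfin_coeff mcoeff0; case: ifP => // hs.
  apply/eqP; rewrite mcoeff_eq0; apply/negP => /msuppM_le /allpairsP [[a b] /= [_]].
  rewrite msuppX inE => /eqP -> e.
  by move: hs; rewrite e => /stdm_addl; rewrite (negbTE ns).
move=> h.
have hns m : m \in msupp f -> exists e : 'I_n * 'I_n, redex m e.1 e.2.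
  move=> hm; have := pick_redexP m; case: pick_redex => [e|hs]; first by exists e.
  move/mpolyP: h => /(_ m); rewrite nfin_coeff hs mcoeff0 => /eqP.
  by rewrite mcoeff_eq0 hm.
pose s := msupp f; pose mm (l : 'I_(size s)) := tnth (in_tuple s) l.
have /fin_all_exists [e he] (l : 'I_(size s)) : exists e : 'I_n * 'I_n, redex (mm l) e.1 e.2.
  exact/hns/mem_tnth.
(* One summand for each monomial of the support: a chosen redex supplies the generator and the
   quotient supplies the cofactor. *)
exists (size s), (fun l => f@_(mm l) *: 'X_[mm l - (X (e l).1 + Y (e l).2)]),
  (fun l => xk (e l).1 * yk (e l).2 - xk (e l).2 * yk (e l).1),
  (fun l => X (e l).1 + Y (e l).2)%MM.
split=> [l|].
  have [lij gij _] := split_redex (he l).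
  set i := (e l).1 in lij gij *; set j := (e l).2 in lij gij *.
  have eb : xk i * yk j - xk j * yk i = 'X_[X i + Y j] - 'X_[X j + Y i].
    by rewrite !mpolyXD.
  have hlt := ltlex_binomial 0%MM lij; rewrite !add0m in hlt.
  have ne : (X j + Y i == X i + Y j :> mono)%MM = false.
    by apply: contraTF hlt => /eqP ->; apply: ltlex_irr.
  have hm : (X i + Y j)%MM \in msupp ('X_[X i + Y j] - 'X_[X j + Y i] : poly).
    by rewrite mcoeff_msupp mcoeffB !mcoeffX eqxx ne subr0 oner_eq0.
  split; first exact: edge_ideal_gen.
    by rewrite eb; apply: contraTneq hm => ->; rewrite mcoeff_msupp mcoeff0 eqxx.
  rewrite eb; split=> // m' /msuppB_le; rewrite !msuppX !inE.
  by case/orP => /eqP -> //; rewrite eqxx.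
rewrite {1}[f]mpolyE big_tnth; apply: eq_bigr => l _.
have [lij gij [p hp]] := split_redex (he l).
have ep : (mm l - (X (e l).1 + Y (e l).2) + (X (e l).1 + Y (e l).2))%MM = mm l.
  by rewrite hp addmK.
by rewrite -scalerAl -mpolyXD ep.
Qed.

Lemma edge_ideal_mulX f t : J f -> J ('X_t * f).
Proof. exact: edge_idealM. Qed.

Lemma initial_ideal_mulX f t : initial_ideal J f -> initial_ideal J ('X_t * f).
Proof.
case=> r [q [g [lm [hg ->]]]]; exists r, (fun l => 'X_t * q l), g, lm; split=> //.
by rewrite mulr_sumr; apply: eq_bigr => l _; rewrite mulrA.
Qed.

End Ideals.
End Rewriting.

Local Close Scope ring_scope.

(** * Standard monomials of a chain of intervals *)

Section Block.
Variables a p c e : nat.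
Implicit Types (P Q : nat -> bool) (i j t : nat).

(** [P] and [Q] say which $x_t$ and $y_t$ divide a monomial. On the interval $[a,e]$ the non-edges
    are the pairs $i<p$, $c<j$, and a standard monomial may contain $x_iy_j$ with $i<j$ only for
    these. *)
Definition stdb P Q : Prop :=
  forall i j, a <= i -> i < j -> j <= e -> P i -> Q j -> (i < p) && (c < j).

(* [j] is the largest [y]-index in [(a, e]] ([a] if none) and [i] the smallest
   [x]-index in [[a, e)] below [j] ([e] if none). *)
Record block_class P Q i j : Prop := BlockClass {
  bc_j : a <= j <= e;
  bc_i : a <= i <= e;
  bc_jQ : a < j -> Q j;
  bc_Qj : forall t, a < t <= e -> Q t -> t <= j;
  bc_iP : i < e -> P i && (i < j);
  bc_Pi : forall t, a <= t < e -> t < j -> P t -> i <= t }.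

(** The outer [maxn a] here, and the minimum written below as $e$ minus a maximum, produce the
    defaults $a$ and $e$ when no index qualifies. *)
Definition jmax Q := maxn a (\max_(t < e.+1 | (a < t) && Q t) t).
Definition imin P Q :=
  e - \max_(t < e | [&& a <= t, t < jmax Q & P t]) (e - t).

(** The non-free variables of the piece $(i,j)$. A new $x_t$ with $t<i$, $t<j$ lowers $i$, and one
    with $p\le t<j$ forms a redex with $y_j$. A new $y_t$ with $t>j$ raises $j$, and one with
    $i<t\le c$ forms a redex with $x_i$. *)
Definition vx i j t := (t < j) && ((t < i) || (p <= t)).
Definition vy i j t := (j < t) || ((i < t) && (t <= c)).

Hypotheses (ap : a < p) (pc : p < c) (ce : c < e).

Lemma block_classP P Q : block_class P Q (imin P Q) (jmax Q).
Proof.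
have hj : jmax Q = a \/ [/\ a < jmax Q, jmax Q <= e & Q (jmax Q)].
  have [h|h] := leqP (\max_(t < e.+1 | (a < t) && Q t) t) a.
    by left; apply/maxn_idPl.
  right; have -> : jmax Q = \max_(t < e.+1 | (a < t) && Q t) t by apply/maxn_idPr/ltnW.
  case: (pickP (fun t : 'I_e.+1 => (a < t) && Q t)) => [t0 h0|h0]; last first.
    by move: h; rewrite big_pred0.
  have h0' : 0 < #|[pred t : 'I_e.+1 | (a < t) && Q t]| by apply/card_gt0P; exists t0.
  have [t /andP [h1 h2] ->] := eq_bigmax_cond (fun t : 'I_e.+1 => t : nat) h0'.
  by split=> //; rewrite -ltnS.
have hQ t : a < t <= e -> Q t -> t <= jmax Q.
  move=> /andP [h1 h2] qt; rewrite leq_max; apply/orP; right.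
  have h3 : t < e.+1 by [].
  by apply: (@leq_bigmax_cond _ _ (fun t : 'I_e.+1 => t : nat) (Ordinal h3)); rewrite /= h1.
have hi : imin P Q = e \/ [/\ a <= imin P Q, imin P Q < e, imin P Q < jmax Q & P (imin P Q)].
  rewrite /imin.
  case: (pickP (fun t : 'I_e => [&& a <= t, t < jmax Q & P t])) => [t0 h0|h0]; last first.
    by left; rewrite big_pred0 // subn0.
  have h0' : 0 < #|[pred t : 'I_e | [&& a <= t, t < jmax Q & P t]]|.
    by apply/card_gt0P; exists t0.
  right; have [t /and3P [h1 h2 h3] ->] := eq_bigmax_cond (fun t : 'I_e => e - t) h0'.
  have te := ltn_ord t; have -> : e - (e - t) = t by lia.
  by split.
split=> //.
- by case: hj => [->|[]]; lia.
- by case: hi => [->|[]]; lia.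
- by case: hj => [->|[]] //; lia.
- by case: hi => [->|[_ _ -> ->]] //; lia.
- move=> t /andP [h1 h2] h3 h4; rewrite /imin leq_subLR addnC -leq_subLR.
  by apply: (@leq_bigmax_cond _ _ (fun t : 'I_e => e - t) (Ordinal h2)); rewrite /= h1 h3.
Qed.

(** More $y$-variables can only raise $j$, which only enlarges the range in which the smallest
    $x$-index is sought. *)
Lemma block_class_mono P Q P' Q' i j i' j' :
  (forall t, a <= t < e -> P t -> P' t) -> (forall t, a < t <= e -> Q t -> Q' t) ->
  block_class P Q i j -> block_class P' Q' i' j' -> i' <= i /\ j <= j'.
Proof.
move=> hP hQ [j1 i1 jQ Qj iP Pi] [j1' i1' jQ' Qj' iP' Pi'].
have jj : j <= j'.
  have [h|h] := leqP j a; first by lia.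
  by apply: Qj'; [lia | apply: hQ; [lia | apply: jQ]].
split=> //; have [h|h] := leqP e i; first by lia.
have /andP [h1 h2] := iP h.
by apply: Pi'; [lia | lia | apply: hP => //; lia].
Qed.

Lemma block_class_uniq P Q i j i' j' :
  block_class P Q i j -> block_class P Q i' j' -> i = i' /\ j = j'.
Proof.
move=> h h'; have [] := block_class_mono _ _ h h' => //.
by have [] := block_class_mono _ _ h' h => //; lia.
Qed.

Lemma stdb_top P Q i j : stdb P Q -> block_class P Q i j -> i < e -> (i < p) && (c < j).
Proof.
move=> hs [j1 i1 jQ Qj iP Pi] /iP /andP [h1 h2].
by apply: hs h1 _ => //; [lia | lia | apply: jQ; lia].
Qed.

(** A free $s$ satisfies $s\ge j$, where no later $y$ exists, or $i\le s<p$. In the second case any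
    $y$-index above $s$ is also above $i$, so it exceeds $c$ by standardness of the pair with
    $x_i$. *)
Lemma block_free_x P P' Q i j s :
  stdb P Q -> block_class P Q i j -> (forall t, P' t = P t || (t == s)) ->
  (a <= s < e -> ~~ vx i j s) -> stdb P' Q /\ block_class P' Q i j.
Proof.
rewrite /vx => hs hc hP hv; case: (hc) => j1 i1 jQ Qj iP Pi; split.
  move=> x y ax xy ye; rewrite hP => /orP [Px|/eqP ex] Qy; first exact: hs.
  have yj : y <= j by apply: Qj => //; lia.
  have is_ : i <= x < p by have := hv; lia.
  have /andP [Pi_ ij] : P i && (i < j) by apply: iP; lia.
  have : (i < p) && (c < y) by apply: hs => //; lia.
  by lia.
split=> //.
- by move=> h; rewrite hP; case/andP: (iP h) => -> ->.
- move=> t h1 h2; rewrite hP => /orP [Pt|/eqP et]; first exact: Pi.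
  by have := hv; lia.
Qed.

(** An $x$-index $x$ below the free index $s\le j$ satisfies $i\le x<s$, which forces $c<s$; the
    bound $x<p$ comes from the old pair of $x$ with $j$. *)
Lemma block_free_y P Q Q' i j s :
  stdb P Q -> block_class P Q i j -> (forall t, Q' t = Q t || (t == s)) ->
  (a < s <= e -> ~~ vy i j s) -> stdb P Q' /\ block_class P Q' i j.
Proof.
rewrite /vy => hs hc hQ hv; case: (hc) => j1 i1 jQ Qj iP Pi; split.
  move=> x y ax xy ye Px; rewrite hQ => /orP [Qy|/eqP ey]; first exact: hs.
  have ix : i <= x by apply: Pi => //; have := hv; lia.
  have : (x < p) && (c < j).
    apply: hs => //; [have := hv; lia | lia | apply: jQ; have := hv; lia].
  by have := hv; lia.
split=> //.
- by move=> h; rewrite hQ jQ.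
- move=> t h1; rewrite hQ => /orP [Qt|/eqP et]; first exact: Qj.
  by have := hv; lia.
Qed.

(** The case $p\le s$ would create a redex with $y_j$, so $s<i$ and the minimum drops to at most
    $s$. *)
Lemma block_bound_x P P' Q i j i' j' s :
  stdb P' Q -> block_class P Q i j -> block_class P' Q i' j' ->
  (forall t, P t -> P' t) -> P' s -> a <= s < e -> vx i j s ->
  i' + (e - j') < i + (e - j).
Proof.
rewrite /vx => hs hc hc' hP Ps se hv.
have [_ jj] := block_class_mono (fun t _ => hP t) (fun t _ h => h) hc hc'.
case: (hc) (hc') => j1 i1 jQ Qj iP Pi [j1' i1' jQ' Qj' iP' Pi'].
have [ps|sp] := leqP p s.
  have : (s < p) && (c < j) by apply: hs => //; [lia | lia | lia | apply: jQ; lia].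
  by lia.
have : i' <= s by apply: Pi' => //; lia.
by lia.
Qed.

Lemma block_bound_y P Q Q' i j i' j' s :
  stdb P Q' -> block_class P Q i j -> block_class P Q' i' j' ->
  (forall t, Q t -> Q' t) -> Q' s -> a < s <= e -> vy i j s ->
  i' + (e - j') < i + (e - j).
Proof.
rewrite /vy => hs hc hc' hQ Qs se hv.
have [ii jj] := block_class_mono (fun t _ h => h) (fun t _ => hQ t) hc hc'.
case: (hc) (hc') => j1 i1 jQ Qj iP Pi [j1' i1' jQ' Qj' iP' Pi'].
have [js|sj] := ltnP j s; first by have := Qj' s se Qs; lia.
have /andP [Pi_ ij] : P i && (i < j) by apply: iP; lia.
have : (i < p) && (c < s) by apply: hs => //; lia.
by lia.
Qed.

Lemma block_class_eq P Q P' Q' i j :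
  (forall t, a <= t < e -> P t = P' t) -> (forall t, a < t <= e -> Q t = Q' t) ->
  block_class P Q i j -> block_class P' Q' i j.
Proof.
move=> hP hQ [j1 i1 jQ Qj iP Pi]; split=> //.
- by move=> h; rewrite -hQ ?jQ //; lia.
- by move=> t h; rewrite -hQ //; apply: Qj.
- by move=> h; case/andP: (iP h) => h1 h2; rewrite -hP ?h1 //; lia.
- by move=> t h; rewrite -hP //; apply: Pi.
Qed.

End Block.

(** * Gluing the intervals: pieces, their generators and their non-free variables *)

Section Pieces.
Variables (n : nat) (G : rel 'I_n) (M : finType).
Variables (a p c e : M -> nat).
Hypothesis ap : forall b, a b < p b.
Hypothesis pc : forall b, p b < c b.
Hypothesis ce : forall b, c b < e b.
Hypothesis en : forall b, e b < n.
(** Different intervals may share an endpoint. With $x$-indices taken in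
    $[a,e)$ and $y$-indices in $(a,e]$, each variable still belongs to at most one interval. *)
Hypothesis disj : forall t b b', a b <= t < e b -> a b' <= t < e b' -> b = b'.
Hypothesis edge : forall i j : 'I_n, i < j ->
  (G i j <-> exists b, [/\ a b <= i, j <= e b & ~~ ((i < p b) && (c b < j))]).
Local Notation mono := 'X_{1..n + n}.
Local Notation X i := (U_(lshift n i))%MM.
Local Notation Y i := (U_(rshift n i))%MM.
Local Notation std := (stdm G).

Definition sx (m : mono) (t : nat) : bool :=
  if insub t is Some i then 0 < m (lshift n i) else false.
Definition sy (m : mono) (t : nat) : bool :=
  if insub t is Some i then 0 < m (rshift n i) else false.

Lemma sxE m (i : 'I_n) : sx m i = (0 < m (lshift n i)).
Proof. by rewrite /sx valK. Qed.
Lemma syE m (i : 'I_n) : sy m i = (0 < m (rshift n i)).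
Proof. by rewrite /sy valK. Qed.

Lemma sx_lt m t : sx m t -> t < n.
Proof. by rewrite /sx; case: insubP. Qed.
Lemma sy_lt m t : sy m t -> t < n.
Proof. by rewrite /sy; case: insubP. Qed.

Lemma sxDX m (s : 'I_n) t : sx (m + X s) t = sx m t || (t == s).
Proof.
rewrite /sx; case: insubP => [i _ <-|h].
  by rewrite mnmDE xvar_l addn_gt0 eq_sym -(inj_eq val_inj); case: (val i == val s).
by apply/esym/negbTE; apply: contraNneq h => ->.
Qed.
Lemma syDY m (s : 'I_n) t : sy (m + Y s) t = sy m t || (t == s).
Proof.
rewrite /sy; case: insubP => [i _ <-|h].
  by rewrite mnmDE yvar_r addn_gt0 eq_sym -(inj_eq val_inj); case: (val i == val s).
by apply/esym/negbTE; apply: contraNneq h => ->.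
Qed.
Lemma sxDY m (s : 'I_n) t : sx (m + Y s) t = sx m t.
Proof. by rewrite /sx; case: insubP => // i _ _; rewrite mnmDE yvar_l addn0. Qed.
Lemma syDX m (s : 'I_n) t : sy (m + X s) t = sy m t.
Proof. by rewrite /sy; case: insubP => // i _ _; rewrite mnmDE xvar_r addn0. Qed.

Lemma sx_mono m m' t : (m <= m')%MM -> sx m t -> sx m' t.
Proof.
move=> /mnm_lepP h; rewrite /sx; case: insubP => // i _ _ h0.
exact: leq_trans h0 (h _).
Qed.
Lemma sy_mono m m' t : (m <= m')%MM -> sy m t -> sy m' t.
Proof.
move=> /mnm_lepP h; rewrite /sy; case: insubP => // i _ _ h0.
exact: leq_trans h0 (h _).
Qed.

Lemma stdmP m : std m <-> forall b, stdb (a b) (p b) (c b) (e b) (sx m) (sy m).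
Proof.
split.
  move=> h b i j ai ij je Pi Qj.
  have hi := sx_lt Pi; have hj := sy_lt Qj.
  move/forallP: h => /(_ (Ordinal hi)) /forallP /(_ (Ordinal hj)).
  rewrite /redex /= ij -sxE -syE Pi Qj !andbT /=.
  apply: contraNT => hn; apply/(edge (i := Ordinal hi) (j := Ordinal hj)) => //.
  by exists b.
move=> h; apply/forallP => i; apply/forallP => j; apply/and4P => -[ij].
move/(edge ij) => [b [ai je /negP hn]]; rewrite -sxE -syE => Pi Qj; apply: hn.
exact: (h b).
Qed.

Definition min_x (m : mono) : {ffun M -> nat} :=
  [ffun b => imin (a b) (e b) (sx m) (sy m)].
Definition max_y (m : mono) : {ffun M -> nat} := [ffun b => jmax (a b) (e b) (sy m)].

(* The variables [x_(n-1)] and [y_0] lie in no block, hence are free. *)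
Definition nonfree_of (i j : {ffun M -> nat}) : {set 'I_(n + n)} :=
  [set z | match split z with
    | inl t => [exists b, (a b <= t < e b) && vx (p b) (i b) (j b) t]
    | inr t => [exists b, (a b < t <= e b) && vy (c b) (i b) (j b) t] end].

Definition gen_of (i j : {ffun M -> nat}) : mono :=
  [multinom (match split z with
    | inl t => [exists b, (a b <= t < e b) && (t == i b :> nat)] : nat
    | inr t => [exists b, (a b < t <= e b) && (t == j b :> nat)] : nat end) | z < n + n].

Definition nonfree m := nonfree_of (min_x m) (max_y m).
Definition piece_gen m := gen_of (min_x m) (max_y m).
Definition piece_key m : nat := \sum_b (min_x m b + (e b - max_y m b)).

Local Notation bclass b m := (block_class (a b) (e b) (sx m) (sy m)).

Lemma min_x_max_yP m b : bclass b m (min_x m b) (max_y m b).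
Proof. by rewrite !ffunE; apply: block_classP. Qed.

Lemma min_x_max_y_mono m m' b : (m <= m')%MM ->
  min_x m' b <= min_x m b /\ max_y m b <= max_y m' b.
Proof.
move=> h; apply: (block_class_mono (ap b) (pc b) (ce b))
  (min_x_max_yP m b) (min_x_max_yP m' b) => t _.
  exact: sx_mono.
exact: sy_mono.
Qed.

Lemma min_x_max_y_uniq m (i j : {ffun M -> nat}) : (forall b, bclass b m (i b) (j b)) ->
  min_x m = i /\ max_y m = j.
Proof.
by move=> h; split; apply/ffunP => b;
  have [] := block_class_uniq (ap b) (pc b) (ce b) (min_x_max_yP m b) (h b).
Qed.

Lemma piece_key_lt m : piece_key m < (\sum_b (e b + e b)).+1.
Proof.
rewrite ltnS; apply: leq_sum => b _; have [h1 h2 _ _ _ _] := min_x_max_yP m b.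
by lia.
Qed.

Lemma nonfree_l i j (t : 'I_n) : (lshift n t \in nonfree_of i j) =
  [exists b, (a b <= t < e b) && vx (p b) (i b) (j b) t].
Proof. by rewrite inE (unsplitK (inl t)). Qed.
Lemma nonfree_r i j (t : 'I_n) : (rshift n t \in nonfree_of i j) =
  [exists b, (a b < t <= e b) && vy (c b) (i b) (j b) t].
Proof. by rewrite inE (unsplitK (inr t)). Qed.
Lemma gen_l i j (t : 'I_n) : gen_of i j (lshift n t) =
  [exists b, (a b <= t < e b) && (t == i b :> nat)].
Proof. by rewrite mnmE (unsplitK (inl t)). Qed.
Lemma gen_r i j (t : 'I_n) : gen_of i j (rshift n t) =
  [exists b, (a b < t <= e b) && (t == j b :> nat)].
Proof. by rewrite mnmE (unsplitK (inr t)). Qed.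

Lemma lr_ind (P : 'I_(n + n) -> Prop) :
  (forall t, P (lshift n t)) -> (forall t, P (rshift n t)) -> forall z, P z.
Proof. by move=> hl hr z; rewrite -(splitK z); case: (split z) => t /=. Qed.

Lemma disjY (t : nat) b b' : a b < t <= e b -> a b' < t <= e b' -> b = b'.
Proof. by case: t => // t h h'; apply: (@disj t); lia. Qed.

Lemma nonfree_mul_free m t : std m -> t \notin nonfree m ->
  [/\ std (m + U_(t))%MM, min_x (m + U_(t)) = min_x m & max_y (m + U_(t)) = max_y m].
Proof.
move=> /stdmP hs.
suff h : t \notin nonfree m -> forall b,
    stdb (a b) (p b) (c b) (e b) (sx (m + U_(t))) (sy (m + U_(t))) /\
    bclass b (m + U_(t))%MM (min_x m b) (max_y m b).
  move=> /h {}h; have [] := min_x_max_y_uniq (fun b => (h b).2) => -> ->; split=> //.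
  by apply/stdmP => b; case: (h b).
elim/lr_ind: t => t; rewrite ?nonfree_l ?nonfree_r negb_exists => /forallP hv b.
  have hb : a b <= t < e b -> ~~ vx (p b) (min_x m b) (max_y m b) t.
    by move=> h; have := hv b; rewrite h.
  have [h1 h2] := block_free_x (ap b) (pc b) (ce b) (hs b) (min_x_max_yP m b) (sxDX m t) hb.
  split; last by apply: block_class_eq h2 => // s _; rewrite syDX.
  by move=> x y h3 h4 h5 h6; rewrite syDX; apply: h1.
have hb : a b < t <= e b -> ~~ vy (c b) (min_x m b) (max_y m b) t.
  by move=> h; have := hv b; rewrite h.
have [h1 h2] := block_free_y (ap b) (pc b) (ce b) (hs b) (min_x_max_yP m b) (syDY m t) hb.
split; last by apply: block_class_eq h2 => // s _; rewrite sxDY.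
by move=> x y h3 h4 h5; rewrite sxDY; apply: h1.
Qed.

(** The summand of the interval containing the variable drops strictly; by monotonicity no other
    summand grows. *)
Lemma nonfree_mul_bound m t : t \in nonfree m -> std (m + U_(t))%MM ->
  piece_key (m + U_(t)) < piece_key m.
Proof.
move=> ht /stdmP hs.
have [b0 hb0] : exists b, min_x (m + U_(t))%MM b + (e b - max_y (m + U_(t))%MM b)
    < min_x m b + (e b - max_y m b).
  elim/lr_ind: t ht hs => t; rewrite ?nonfree_l ?nonfree_r => /existsP [b /andP [h1 h2]] hs; exists b.
    apply: (block_bound_x (ap b) (pc b) (ce b) (P := sx m) (P' := sx (m + X t)) (Q := sy m)
      (s := t)) => //.
    - by move=> x y h3 h4 h5 h6 h7; apply: (hs b) h6 _ => //; rewrite syDX.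
    - exact: min_x_max_yP.
    - by apply: block_class_eq (min_x_max_yP (m + X t) b) => // s _; rewrite syDX.
    - by move=> s; rewrite sxDX => ->.
    - by rewrite sxDX eqxx orbT.
  apply: (block_bound_y (ap b) (pc b) (ce b) (P := sx m) (Q := sy m) (Q' := sy (m + Y t))
    (s := t)) => //.
  - by move=> x y h3 h4 h5 h6 h7; apply: (hs b) _ h7 => //; rewrite sxDY.
  - exact: min_x_max_yP.
  - by apply: block_class_eq (min_x_max_yP (m + Y t) b) => // s _; rewrite sxDY.
  - by move=> s; rewrite syDY => ->.
  - by rewrite syDY eqxx orbT.
rewrite /piece_key (bigD1 b0) //= [Z in _ < Z](bigD1 b0) //= -addSn.
apply: leq_add => //; apply: leq_sum => b _.
by have [h1 h2] := min_x_max_y_mono b (lem_addr m U_(t)%MM); lia.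
Qed.

(** If the variable already divided $m$, the strict drop for one more non-free variable would apply
    from $m$ to itself. *)
Lemma nonfree_supp0 m t : std m -> t \in nonfree m -> m t = 0.
Proof.
move=> /stdmP hs; elim/lr_ind: t => t; rewrite ?nonfree_l ?nonfree_r;
  case/existsP => b /andP [h1 h2];
  apply/eqP; rewrite -leqn0 leqNgt; apply/negP; rewrite -?sxE -?syE => ht.
  by have := block_bound_x (ap b) (pc b) (ce b) (hs b) (min_x_max_yP m b) (min_x_max_yP m b)
    (fun t h => h) ht h1 h2; rewrite ltnn.
by have := block_bound_y (ap b) (pc b) (ce b) (hs b) (min_x_max_yP m b) (min_x_max_yP m b)
  (fun t h => h) ht h1 h2; rewrite ltnn.
Qed.

Lemma piece_gen_le m t : piece_gen m t <= m t.
Proof.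
elim/lr_ind: t => t; rewrite ?gen_l ?gen_r; case: existsP => // -[b /andP [h1 /eqP h2]].
  have [_ _ _ _ iP _] := min_x_max_yP m b; rewrite -sxE h2.
  by have /andP [-> _] : sx m (min_x m b) && (min_x m b < max_y m b) by apply: iP; lia.
have [_ _ jQ _ _ _] := min_x_max_yP m b; rewrite -syE h2.
by have -> : sy m (max_y m b) by apply: jQ; lia.
Qed.

Definition class_ok (i j : {ffun M -> nat}) := forall b,
  [/\ a b <= j b <= e b, a b <= i b <= e b & i b < e b -> i b < j b].

Lemma min_x_max_y_ok m : class_ok (min_x m) (max_y m).
Proof.
move=> b; have [h1 h2 _ _ iP _] := min_x_max_yP m b; split=> //.
by move=> /iP /andP [].
Qed.

Lemma sx_gen_of i j (t b : _) : a b <= t < e b -> sx (gen_of i j) t = (t == i b).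
Proof.
move=> hb; have tn : t < n by have := en b; lia.
rewrite -[t]/(nat_of_ord (Ordinal tn)) sxE gen_l lt0b; apply/existsP/eqP => /=.
  by case=> b' /andP [hb' /eqP ->]; rewrite (disj hb hb').
by move=> et; exists b; rewrite hb et eqxx.
Qed.

Lemma sy_gen_of i j (t b : _) : a b < t <= e b -> sy (gen_of i j) t = (t == j b).
Proof.
move=> hb; have tn : t < n by have := en b; lia.
rewrite -[t]/(nat_of_ord (Ordinal tn)) syE gen_r lt0b; apply/existsP/eqP => /=.
  by case=> b' /andP [hb' /eqP ->]; rewrite (disjY hb hb').
by move=> et; exists b; rewrite hb et eqxx.
Qed.

(** Each interval holds at most one $x$ and one $y$ of the generator, so the chosen indices can be
    read off again. *)
Lemma gen_of_class i j : class_ok i j -> min_x (gen_of i j) = i /\ max_y (gen_of i j) = j.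
Proof.
move=> h; apply: min_x_max_y_uniq => b; have [h1 h2 h3] := h b; split=> //.
- by move=> h4; rewrite (@sy_gen_of _ _ _ b) ?eqxx //; lia.
- by move=> t ht; rewrite (@sy_gen_of _ _ _ b) // => /eqP ->.
- by move=> h4; rewrite (@sx_gen_of _ _ _ b) ?eqxx ?h3 //; lia.
- by move=> t ht _; rewrite (@sx_gen_of _ _ _ b) // => /eqP ->.
Qed.

(** The quotient lies between the generator and $m$ for divisibility; these two have the same class
    and the class is monotone. *)
Lemma nonfree_div_free m t : std m -> t \notin nonfree m -> piece_gen m t < m t ->
  [/\ std (m - U_(t))%MM, min_x (m - U_(t)) = min_x m & max_y (m - U_(t)) = max_y m].
Proof.
move=> hs tV ut.
have le1 : (piece_gen m <= m - U_(t))%MM.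
  apply/mnm_lepP => s; rewrite mnmBE mnm1E.
  by case: (eqVneq t s) ut => [->|_] /=; have := piece_gen_le m s; lia.
have le2 : (m - U_(t) <= m)%MM by apply: lem_subr.
have [e1 e2] := gen_of_class (min_x_max_y_ok m).
have hb b : min_x (m - U_(t))%MM b = min_x m b /\ max_y (m - U_(t))%MM b = max_y m b.
  have [h1 h2] := min_x_max_y_mono b le1; have [h3 h4] := min_x_max_y_mono b le2.
  by rewrite /piece_gen e1 e2 in h1 h2; lia.
split; try by apply/ffunP => b; case: (hb b).
apply: (@stdm_addl _ _ U_(t)%MM); rewrite addmC submK //.
by rewrite lep1mP -lt0n; apply: leq_ltn_trans ut.
Qed.

Lemma sum_itv N lo hi : hi <= N -> \sum_(t < N) (lo <= t < hi : nat) = hi - lo.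
Proof.
suff h : \sum_(t < N) (lo <= t < hi : nat) = minn hi N - lo.
  by move=> hN; rewrite h (minn_idPl hN).
elim: N => [|N IH]; first by rewrite big_ord0; lia.
by rewrite big_ord_recr /= IH; case: (boolP (lo <= N < hi)) => /=; lia.
Qed.

Lemma exists_sum (Q : pred M) : (forall b b', Q b -> Q b' -> b = b') ->
  ([exists b, Q b] : nat) = \sum_b (Q b : nat).
Proof.
move=> h; case: existsP => [[b hb]|hn].
  rewrite (bigD1 b) //= hb big1 // => b' /eqP ne.
  by case hb': (Q b') => //; case: ne; apply: h.
by rewrite big1 // => b _; case hb: (Q b) => //; case: hn; exists b.
Qed.

Definition strip (i j : {ffun M -> nat}) :=
  forall b, i b < e b -> (i b < p b) && (c b < j b).

Lemma min_x_max_y_strip m : std m -> strip (min_x m) (max_y m).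
Proof.
move=> /stdmP hs b; exact: (stdb_top (ap b) (pc b) (ce b) (hs b) (min_x_max_yP m b)).
Qed.

(** An interval with $i<e$ has $(i-a)+(j-p)$ non-free $x$ and $(e-j)+(c-i)$ non-free $y$; otherwise
    the numbers are $j-a$ and $e-j$. In both cases $i$ and $j$ cancel from the total. *)
Lemma card_nonfree_of i j : class_ok i j -> strip i j ->
  #|nonfree_of i j| = \sum_b (e b - a b + (if i b < e b then c b - p b else 0)).
Proof.
move=> hok hst; rewrite -sum1_card big_mkcond big_split_ord /=.
have -> : \sum_(t < n) (if lshift n t \in nonfree_of i j then 1 else 0) =
    \sum_b \sum_(t < n) ((a b <= t < e b) && vx (p b) (i b) (j b) t : nat).
  rewrite exchange_big; apply: eq_bigr => t _; rewrite nonfree_l -exists_sum //.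
  by move=> b b' /andP [h _] /andP [h' _]; apply: disj h h'.
have -> : \sum_(t < n) (if rshift n t \in nonfree_of i j then 1 else 0) =
    \sum_b \sum_(t < n) ((a b < t <= e b) && vy (c b) (i b) (j b) t : nat).
  rewrite exchange_big; apply: eq_bigr => t _; rewrite nonfree_r -exists_sum //.
  by move=> b b' /andP [h _] /andP [h' _]; apply: disjY h h'.
rewrite -big_split; apply: eq_bigr => b _ /=.
have [h1 h2 h3] := hok b; have h4 := hst b; have h5 := en b.
have g1 := ap b; have g2 := pc b; have g3 := ce b.
case: ifP => hi.
  have -> : \sum_(t < n) ((a b <= t < e b) && vx (p b) (i b) (j b) t : nat) =
     \sum_(t < n) ((a b <= t < i b) + (p b <= t < j b)).
    by apply: eq_bigr => t _; rewrite /vx; have := h4 hi; lia.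
  have -> : \sum_(t < n) ((a b < t <= e b) && vy (c b) (i b) (j b) t : nat) =
     \sum_(t < n) (((j b).+1 <= t < (e b).+1) + ((i b).+1 <= t < (c b).+1)).
    by apply: eq_bigr => t _; rewrite /vy; have := h4 hi; lia.
  by rewrite !big_split /= !sum_itv; lia.
have -> : \sum_(t < n) ((a b <= t < e b) && vx (p b) (i b) (j b) t : nat) =
     \sum_(t < n) (a b <= t < j b).
  by apply: eq_bigr => t _; rewrite /vx; lia.
have -> : \sum_(t < n) ((a b < t <= e b) && vy (c b) (i b) (j b) t : nat) =
     \sum_(t < n) ((j b).+1 <= t < (e b).+1).
  by apply: eq_bigr => t _; rewrite /vy; lia.
by rewrite !sum_itv; lia.
Qed.

Lemma mdeg_gen_of i j : class_ok i j ->
  mdeg (gen_of i j) = \sum_b ((i b < e b) + (a b < j b)).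
Proof.
move=> hok; rewrite mdegE big_split_ord /=.
have -> : \sum_(t < n) gen_of i j (lshift n t) =
    \sum_b \sum_(t < n) ((a b <= t < e b) && (t == i b :> nat) : nat).
  rewrite exchange_big; apply: eq_bigr => t _; rewrite gen_l -exists_sum //.
  by move=> b b' /andP [h _] /andP [h' _]; apply: disj h h'.
have -> : \sum_(t < n) gen_of i j (rshift n t) =
    \sum_b \sum_(t < n) ((a b < t <= e b) && (t == j b :> nat) : nat).
  rewrite exchange_big; apply: eq_bigr => t _; rewrite gen_r -exists_sum //.
  by move=> b b' /andP [h _] /andP [h' _]; apply: disjY h h'.
rewrite -big_split; apply: eq_bigr => b _ /=.
have [h1 h2 h3] := hok b; have h5 := en b.
congr (_ + _).
  have -> : \sum_(t < n) ((a b <= t < e b) && (t == i b :> nat) : nat) =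
     \sum_(t < n) (i b <= t < minn (i b).+1 (e b)).
    by apply: eq_bigr => t _; lia.
  by rewrite sum_itv; lia.
have -> : \sum_(t < n) ((a b < t <= e b) && (t == j b :> nat) : nat) =
     \sum_(t < n) (maxn (j b) (a b).+1 <= t < (j b).+1).
  by apply: eq_bigr => t _; lia.
by rewrite sum_itv; lia.
Qed.

(** Koszul degrees refer to $S/I$, so this value is the $p+1$ of the theorem, and [corner_reg] is
    $r-1$. *)
Definition corner_pd := \sum_b (e b - a b + (c b - p b)).
Definition corner_reg := \sum_(b : M) 2.

Lemma card_nonfree_le m : std m -> #|nonfree m| <= corner_pd.
Proof.
move=> hs; rewrite (card_nonfree_of (min_x_max_y_ok m) (min_x_max_y_strip hs)).
by apply: leq_sum => b _; case: ifP => _; lia.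
Qed.

Lemma mdeg_piece_gen_le m : mdeg (piece_gen m) <= corner_reg.
Proof. by rewrite (mdeg_gen_of (min_x_max_y_ok m)); apply: leq_sum => b _; lia. Qed.

(** A single interval with the default $i=e$ loses $c-p>0$ from the maximal count. *)
Lemma card_nonfree_eq m : std m -> corner_pd <= #|nonfree m| -> forall b, min_x m b < e b.
Proof.
move=> hs; rewrite (card_nonfree_of (min_x_max_y_ok m) (min_x_max_y_strip hs)) /corner_pd => h b.
rewrite ltnNge; apply/negP => hb; move: h; rewrite leqNgt => /negP; apply.
rewrite (bigD1 b) //= [Z in _ < Z](bigD1 b) //= -addSn.
apply: leq_add; last by apply: leq_sum => b' _; case: ifP => _; lia.
by rewrite ifN -?leqNgt //; have := pc b; lia.
Qed.

Lemma mdeg_piece_gen_eq m : std m -> (forall b, min_x m b < e b) ->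
  mdeg (piece_gen m) = corner_reg.
Proof.
move=> hs h; rewrite (mdeg_gen_of (min_x_max_y_ok m)); apply: eq_bigr => b _.
have := min_x_max_y_strip hs (h b); rewrite h; have := ap b; have := pc b; lia.
Qed.

(** * Critical cells and their position in the Betti table *)

Section Crits.
Variable j : nat.
Local Notation cellT := ({set 'I_(n + n)} * 'X_{1..(n + n) < j.+1})%type.

(** Nothing can be toggled exactly when $A$ contains no free variable and $m$ agrees with its
    generator at the free ones; at the non-free ones both exponents are zero. *)
Lemma mem_crits q (z : cellT) : (z \in crits std nonfree piece_gen j q) =
  [&& #|z.1| == q, #|z.1| + mdeg z.2 == j, std z.2, z.1 \subset nonfree z.2
    & val z.2 == piece_gen z.2].
Proof.
rewrite inE mem_cells /okz -!andbA; do 2!congr (_ && _).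
case hs: (std z.2) => //=.
have -> : is_crit nonfree piece_gen z = (tset nonfree piece_gen z.1 z.2 == set0).
  rewrite /is_crit /pivot; have := pivot_ofP (tset nonfree piece_gen z.1 z.2).
  case: (pivot_of _) => [t|->]; rewrite ?eqxx //.
  by move=> ht; apply/esym/negbTE/set0Pn; exists t.
apply/eqP/andP => [h|[/subsetP hA /eqP hu]].
  have ht t : t \notin nonfree z.2 -> (t \notin z.1) && (z.2 t <= piece_gen z.2 t).
    move=> tV; move/setP: h => /(_ t); rewrite in_set in_set0 tV /= => /negbT.
    by rewrite negb_or -leqNgt.
  split.
    apply/subsetP => t; apply: contraTT => /ht /andP [] //.
  apply/eqP/mnmP => t; apply/eqP; rewrite eqn_leq piece_gen_le andbT.
  case: (boolP (t \in nonfree z.2)) => [tV|/ht /andP [] //].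
  by rewrite (nonfree_supp0 hs tV).
apply/setP => t; rewrite in_set in_set0; apply/negP => /andP [tV /orP []].
  by move/hA; rewrite (negbTE tV).
by rewrite -hu ltnn.
Qed.

Lemma crits_corner_pd q : corner_pd < q -> #|crits std nonfree piece_gen j q| = 0.
Proof.
move=> hq; apply/eqP; rewrite cards_eq0; apply/eqP/setP => z.
rewrite mem_crits inE; apply/negP => /and5P [/eqP h1 _ hs /subset_leq_card h2 _].
by have := card_nonfree_le hs; lia.
Qed.

Lemma crits_corner_reg q : q + corner_reg < j -> #|crits std nonfree piece_gen j q| = 0.
Proof.
move=> hq; apply/eqP; rewrite cards_eq0; apply/eqP/setP => z.
rewrite mem_crits inE; apply/negP => /and5P [/eqP h1 /eqP h2 hs _ /eqP h3].
by have := mdeg_piece_gen_le z.2; rewrite -h3 /=; lia.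
Qed.

(** In the top homological degree every interval contributes a full pair, so the degree of the
    generator is forced to be [corner_reg]. *)
Lemma crits_corner0 : j != corner_pd + corner_reg ->
  #|crits std nonfree piece_gen j corner_pd| = 0.
Proof.
move=> hq; apply/eqP; rewrite cards_eq0; apply/eqP/setP => z.
rewrite mem_crits inE; apply/negP => /and5P [/eqP h1 /eqP h2 hs /subset_leq_card h3 /eqP h4].
have := mdeg_piece_gen_eq hs (card_nonfree_eq hs _); rewrite -h4 /= -{1}h1 => /(_ h3).
by move/eqP: hq; lia.
Qed.

End Crits.

Definition corner_family (b : M) : pred ('I_n * 'I_n) :=
  [pred x : 'I_n * 'I_n | (a b <= x.1 < p b) && (c b < x.2 <= e b)].

Definition corner_fst (f : {ffun M -> 'I_n * 'I_n}) := [ffun b => val (f b).1].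
Definition corner_snd (f : {ffun M -> 'I_n * 'I_n}) := [ffun b => val (f b).2].

Lemma card_corner_family : #|family corner_family| = \prod_b ((p b - a b) * (e b - c b)).
Proof.
rewrite card_family foldrE big_map big_enum; apply: eq_bigr => b _ /=.
have hn : e b < n := en b; have g1 := ap b; have g2 := pc b; have g3 := ce b.
have -> : #|corner_family b| =
    #|[predX [pred x : 'I_n | a b <= x < p b] & [pred y : 'I_n | c b < y <= e b]]|.
  by apply: eq_card => x; rewrite !inE.
rewrite cardX; congr (_ * _).
  rewrite -sum1_card big_mkcond -(@sum_itv n (a b) (p b)); last by lia.
  by apply: eq_bigr => t _; rewrite inE; case: ifP.
have -> : e b - c b = (e b).+1 - (c b).+1 by lia.
rewrite -sum1_card big_mkcond -(@sum_itv n (c b).+1 (e b).+1) //.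
Qed.

Lemma crits_corner :
  #|crits std nonfree piece_gen (corner_pd + corner_reg) corner_pd| =
  \prod_b ((p b - a b) * (e b - c b)).
Proof.
rewrite -card_corner_family.
pose D := (corner_pd + corner_reg).+1.
(* A choice of corner pairs gives its generator together with all non-free variables. The generator
   has degree [corner_reg], below [D], so the default of [insubd] does not occur. *)
pose g (f : {ffun M -> 'I_n * 'I_n}) : {set 'I_(n + n)} * 'X_{1..(n + n) < D} :=
  (nonfree_of (corner_fst f) (corner_snd f),
   insubd (@bm0 (n + n) (corner_pd + corner_reg)) (gen_of (corner_fst f) (corner_snd f))).
have ok f : f \in family corner_family ->
    class_ok (corner_fst f) (corner_snd f) /\
    (forall b, (corner_fst f b < p b) && (c b < corner_snd f b)).
  move/familyP => hf; have h b : (a b <= (f b).1 < p b) && (c b < (f b).2 <= e b) := hf b.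
  split=> b; have := h b; have := ap b; have := pc b; have := ce b; rewrite !ffunE /=.
    by split; lia.
  by lia.
have gs f : f \in family corner_family ->
    val (g f).2 = gen_of (corner_fst f) (corner_snd f) /\ mdeg (val (g f).2) = corner_reg.
  move=> hf; have [h1 h2] := ok f hf.
  have hd : mdeg (gen_of (corner_fst f) (corner_snd f)) = corner_reg.
    rewrite mdeg_gen_of //; apply: eq_bigr => b _.
    by have := h2 b; have := ap b; have := pc b; have := ce b; lia.
  by rewrite val_insubd hd ifT //; rewrite /D; lia.
rewrite -(card_in_imset (f := g)); last first.
  move=> f f' hf hf' /(congr1 (fun z => val z.2)).
  have [-> _] := gs _ hf; have [-> _] := gs _ hf' => eu.
  have [e1 e2] := gen_of_class (ok _ hf).1; have [e3 e4] := gen_of_class (ok _ hf').1.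
  have {e1 e3} e1 : corner_fst f = corner_fst f' by rewrite -e1 eu e3.
  have {e2 e4} e2 : corner_snd f = corner_snd f' by rewrite -e2 eu e4.
  apply/ffunP => b; move/ffunP: e1 => /(_ b); move/ffunP: e2 => /(_ b); rewrite !ffunE.
  by case: (f b) (f' b) => [x y] [x' y'] /= /val_inj -> /val_inj ->.
apply: eq_card => z; rewrite mem_crits.
apply/and5P/imsetP => [[/eqP h1 /eqP h2 hs h3 /eqP h4]|[f hf ->]].
  have hV : corner_pd <= #|nonfree z.2| by rewrite -{1}h1; apply: subset_leq_card.
  have ht := card_nonfree_eq hs hV.
  have hst b := min_x_max_y_strip hs (ht b).
  have hok := min_x_max_y_ok z.2.
  have l1 b : min_x z.2 b < n by apply: ltn_trans (ht b) (en b).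
  have l2 b : max_y z.2 b < n.
    by have [h _ _] := hok b; have := en b; lia.
  pose f := [ffun b => (Ordinal (l1 b), Ordinal (l2 b))].
  have f1 : corner_fst f = min_x z.2 by apply/ffunP => b; rewrite !ffunE.
  have f2 : corner_snd f = max_y z.2 by apply/ffunP => b; rewrite !ffunE.
  have hf : f \in family corner_family.
    apply/familyP => b; rewrite inE [f b]ffunE /=; have [k1 k2 _] := hok b.
    have [/andP [k3 k4] /andP [k5 k6] /andP [k7 k8]] := And3 (hst b) k1 k2.
    by apply/and3P; split=> //; apply/andP.
  exists f => //; apply/eqP; rewrite -pair_eqE /pair_eq; apply/andP; split.
    (* $A$ lies in the set of non-free variables and already has the largest size that set can have,
       so the two are equal. *)
    rewrite /= f1 f2 eqEcard -/(nonfree z.2) h3 /= h1.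
    exact: card_nonfree_le.
  rewrite -val_eqE; have [-> _] := gs f hf; rewrite f1 f2.
  exact/eqP.
have [h1 h2] := ok f hf; have [h3 h4] := gs f hf; have [e1 e2] := gen_of_class h1.
have hst : strip (corner_fst f) (corner_snd f) by move=> b _; apply: h2.
have eV : nonfree (g f).2 = (g f).1 by rewrite /nonfree -[bmnm _]/(val (g f).2) h3 e1 e2.
have eu : piece_gen (g f).2 = val (g f).2 by rewrite {1}/piece_gen -[bmnm _]/(val (g f).2) h3 e1 e2.
have c1 : #|(g f).1| = corner_pd.
  rewrite /= card_nonfree_of //; apply: eq_bigr => b _; rewrite ifT //.
  by have := h2 b; have := pc b; have := ce b; lia.
rewrite c1 eV eu !eqxx subxx -[bmnm _]/(val (g f).2) h4 eqxx; split=> //.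
apply/stdmP => b x y ax xy ye; rewrite h3.
rewrite (@sx_gen_of _ _ _ b) ?(@sy_gen_of _ _ _ b); try lia.
by move=> /eqP -> /eqP ->; apply: h2.
Qed.

End Pieces.

(** * Connected closed graphs *)

Lemma connect_inv (T : finType) (r : rel T) (P : pred T) x y :
  (forall u t, r u t -> P u -> P t) -> P x -> connect r x y -> P y.
Proof.
move=> h Px /connectP [s hs ->]; elim: s x Px hs => //= z s IH x Px /andP [rxz hs].
by apply: IH hs; apply: h Px.
Qed.

Lemma card_ord_itv N lo hi : hi <= N -> #|[set t : 'I_N | lo <= t < hi]| = hi - lo.
Proof.
move=> h; rewrite -(sum_itv lo h) -sum1_card big_mkcond /=.
by apply: eq_bigr => t _; rewrite inE; case: ifP.
Qed.

Section ClosedConnected.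
Variables (n : nat) (G : rel 'I_n).
Hypothesis Gsimple : simple_graph G.
Hypothesis Gconn : connected_on G [set: 'I_n].
Hypothesis Gclosed : closed_graph G.

Let Gsym : forall x y, G x y = G y x := Gsimple.2.

Definition upward : rel 'I_n := [rel x y : 'I_n | (x < y) && G x y].

(* Where the directed part of a walk turns around, closedness provides a
   shortcut, so any two vertices are joined by a monotone path. *)
Lemma connect_upward x y : connect upward x y \/ connect upward y x.
Proof.
have hc : connect (induced G [set: 'I_n]) x y by apply: Gconn; rewrite inE.
case/connectP: hc => s; elim/last_ind: s y => [|s z IH] y; first by move=> _ ->; left.
rewrite rcons_path last_rcons => /andP [hs hz] ->.
have {IH} := IH _ hs (erefl _); move: (last x s) hz => t /and3P [_ _ gtz] {hs s y}.
have up_step u w : G u w -> connect upward u w \/ connect upward w u.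
  move=> guw; case: (ltngtP u w) => [h|h|/val_inj ->]; last by left.
    by left; apply: connect1; rewrite /upward /= h.
  by right; apply: connect1; rewrite /upward /= h Gsym.
case=> /connectP [s].
  elim/last_ind: s t gtz => [|s w IH] t gtz; first by move=> _ et; subst t; apply: up_step.
  rewrite rcons_path last_rcons => /andP [hs /andP [lw gw]] et; subst t.
  case: (ltngtP w z) => [h|h|/val_inj <-].
  - left; apply: connect_trans (connect1 (_ : upward w z)); last by rewrite /upward /= h.
    apply: connect_trans (connect1 (_ : upward (last x s) w)); last by rewrite /upward /= lw.
    by apply/connectP; exists s.
  - case: (eqVneq (last x s) z) => [<-|ne]; first by left; apply/connectP; exists s.
    have g : G (last x s) z.
      by apply: (Gclosed (i := w)) => //; [rewrite Gsym | rewrite lw h orbT].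
    exact: IH g hs (erefl _).
  - left; apply: connect_trans (connect1 (_ : upward (last x s) w)); last by rewrite /upward /= lw.
    by apply/connectP; exists s.
elim: s t gtz => [|w s IH] t gtz /=; first by move=> _ ->; apply: up_step.
case/andP => /andP [lw gw] hs ex.
have htx : connect upward t x.
  by apply/connectP; exists (w :: s) => //=; rewrite hs andbT; apply/andP.
case: (ltngtP t z) => [h|h|/val_inj <-]; last by right.
  case: (eqVneq w z) => [<-|ne]; first by right; apply/connectP; exists s.
  by apply: IH hs ex; apply: (Gclosed (i := t)) => //; rewrite lw h.
right; apply: connect_trans htx; apply: connect1.
by rewrite /upward /= h Gsym.
Qed.

(** A monotone path between consecutive labels has room for one step only. *)
Lemma adjacent (x y : 'I_n) : y = x.+1 :> nat -> G x y.
Proof.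
move=> hy; have lxy : x < y by rewrite hy.
have mono u w : connect upward u w -> u <= w.
  move=> h; apply: (connect_inv (P := fun t : 'I_n => u <= t)) (leqnn u) h.
  by move=> a b /andP [ab _] ua; apply: leq_trans (ltnW ab).
case: (connect_upward x y) => [|/mono]; last by rewrite leqNgt lxy.
case/connectP => -[|z s] /=; first by move=> _ e; rewrite e ltnn in lxy.
case/andP => /andP [xz gxz] hs ey.
have zy : z <= y by apply: mono; apply/connectP; exists s.
suff -> : y = z by [].
by apply: val_inj => /=; lia.
Qed.

(** The edge is shrunk one label at a time, first from the left and then from the right: consecutive
    labels are adjacent, and closedness transfers the edge to the next label. *)
Lemma clique_interval (u w x y : 'I_n) :
  G u w -> u <= x -> x < y -> y <= w -> G x y.
Proof.
move=> guw ux xy yw; have gxw : G x w.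
  have [d] := ubnP (x - u); elim: d x ux xy => // d IH x ux xy hd.
  case: (ltngtP u x) ux => // [ltux _|/val_inj <- _] //.
  have hx : x.-1 < n by have := ltn_ord x; lia.
  have g1 : G (Ordinal hx) w by apply: IH => /=; lia.
  have g2 : G (Ordinal hx) x by apply: adjacent => /=; lia.
  apply: Gclosed g2 g1 _ _; last by rewrite /=; lia.
  by rewrite -val_eqE /=; lia.
have [d] := ubnP (w - y); elim: d y xy yw => // d IH y xy yw hd.
case: (ltngtP y w) yw => // [ltyw _|/val_inj -> _] //.
have hy : y.+1 < n by have := ltn_ord w; lia.
have g1 : G x (Ordinal hy) by apply: IH => /=; lia.
have g2 : G y (Ordinal hy) by apply: adjacent.
rewrite Gsym; apply: (Gclosed (i := Ordinal hy)); rewrite 1?Gsym //.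
  by rewrite -val_eqE /=; lia.
by rewrite /=; lia.
Qed.

(** [S] can be left through one vertex only. A gap at $w$ between two members of [S] would provide
    two exits, one below $w$ and one above. *)
Lemma convex_gate (S : pred 'I_n) :
  (forall x y x' y', G x y -> S x -> ~~ S y -> G x' y' -> S x' -> ~~ S y' -> x = x') ->
  forall u w z : 'I_n, u <= w -> w <= z -> S u -> S z -> S w.
Proof.
move=> gate u w z uw wz Su Sz; apply: contraT => Sw.
have [x [y [hx hy1 hy2 hy3]]] : exists x y : 'I_n,
    [/\ x < w, G x y, S x & ~~ S y].
  have [d] := ubnP (w - u); elim: d w uw {wz} Sw => // d IH w uw Sw hd.
  have ltuw : u < w.
    rewrite ltn_neqAle uw andbT; apply: contraNneq Sw => /val_inj <-.
    exact: Su.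
  have hw : w.-1 < n by have := ltn_ord w; lia.
  case S1: (S (Ordinal hw)).
    exists (Ordinal hw), w; split=> //=; first lia.
    by apply: adjacent => /=; lia.
  have [|||x [y [h1 h2 h3 h4]]] := IH (Ordinal hw); rewrite ?S1 //=; try lia.
  by exists x, y; split=> //; rewrite /= in h1; lia.
have [x' [y' [hx' hy1' hy2' hy3']]] : exists x y : 'I_n,
    [/\ w < x, G x y, S x & ~~ S y].
  have [d] := ubnP (z - w); elim: d w wz {uw hx} Sw => // d IH w wz Sw hd.
  have ltwz : w < z.
    rewrite ltn_neqAle wz andbT; apply: contraNneq Sw => /val_inj ->.
    exact: Sz.
  have hw : w.+1 < n by have := ltn_ord z; lia.
  case S1: (S (Ordinal hw)).
    exists (Ordinal hw), w; split=> //=.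
    by rewrite Gsym; apply: adjacent.
  have [|||x' [y' [h1 h2 h3 h4]]] := IH (Ordinal hw); rewrite ?S1 //=; try lia.
  by exists x', y'; split=> //; rewrite /= in h1; lia.
by have e := gate _ _ _ _ hy1 hy2 hy3 hy1' hy2' hy3'; rewrite e in hx; lia.
Qed.

(** * The shape of one block from its sequence $\mu$ *)

Section IntervalBlock.
Variables (X : {set 'I_n}) (a e : nat).
Hypothesis en : e < n.
Hypothesis ae : a <= e.
Hypothesis XE : forall x : 'I_n, (x \in X) = (a <= x <= e).

Lemma sortedV_interval : map val (sortedV X) = iota a (e.+1 - a).
Proof.
have -> : map val (sortedV X) = sort leq (map val (enum X)) by rewrite sort_map.
apply: (sorted_eq leq_trans anti_leq).
- exact/sort_sorted/leq_total.
- exact: iota_sorted.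
rewrite perm_sort; apply: uniq_perm; rewrite ?iota_uniq //.
  by rewrite map_inj_uniq ?enum_uniq //; apply: val_inj.
move=> t; rewrite mem_iota; apply/mapP/idP => [[x]|h].
  by rewrite mem_enum XE => h -> /=; lia.
have tn : t < n by lia.
by exists (Ordinal tn) => //; rewrite mem_enum XE /=; lia.
Qed.

Lemma size_sortedV : size (sortedV X) = e.+1 - a.
Proof. by rewrite -(size_map val) sortedV_interval size_iota. Qed.

Lemma size_mu_seq : size (mu_seq G X) = e.+1 - a.
Proof.
rewrite /mu_seq -size_sortedV; case: (sortedV X) => //= d s.
by rewrite size_map size_iota.
Qed.

Lemma nth_mu_seq k (x : 'I_n) : x = a + k :> nat -> x <= e ->
  nth 0 (mu_seq G X) k = (e - x) - deg_gt G X x.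
Proof.
move=> hx xe; have hs := sortedV_interval; have hz := size_sortedV.
rewrite /mu_seq; case: (sortedV X) hs hz => [|d s]; first by rewrite /=; lia.
move=> hs hz; rewrite (nth_map 0) ?size_iota ?hz; last by lia.
rewrite nth_iota ?hz ?add0n; last by lia.
have -> : nth d (d :: s) k = x.
  apply: val_inj; rewrite -(nth_map d (val d)) ?hz; last by lia.
  by rewrite hs nth_iota //; lia.
by congr (_ - _); lia.
Qed.

(** The larger neighbours of $u$ in the block form an interval starting at $u+1$, so their number
    determines them. *)
Lemma deg_gtP (u w : 'I_n) : a <= u -> u < w -> w <= e ->
  G u w = (w <= u + deg_gt G X u).
Proof.
move=> au uw we; rewrite /deg_gt; set S := [set _ | _ & _].
apply/idP/idP => [guw|].
  have : [set t : 'I_n | u.+1 <= t < w.+1] \subset S.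
    apply/subsetP => t; rewrite !inE XE => /andP [h1 h2].
    by rewrite h1 (clique_interval guw _ h1) //; lia.
  move/subset_leq_card; rewrite card_ord_itv; last by have := ltn_ord w; lia.
  by rewrite subSS leq_subLR.
apply: contraTT => guw; rewrite -ltnNge.
have : S \subset [set t : 'I_n | u.+1 <= t < w].
  apply/subsetP => t; rewrite !inE XE => /and3P [h1 h2 h3]; rewrite h2 /= ltnNge.
  by apply: contra guw => wt; apply: (clique_interval h3).
move/subset_leq_card; rewrite card_ord_itv; last by have := ltn_ord w; lia.
by move=> h; rewrite -ltn_subRL; apply: leq_ltn_trans h _; lia.
Qed.

Hypothesis s1 : 1 <= s_of G X.
Hypothesis mu_const : forall l, l < s_of G X -> nth 0 (mu_seq G X) l = mu1_of G X.
Hypothesis mu1 : 1 <= mu1_of G X.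
Hypothesis no_cut : forall w, ~ cut_vertex G X w.

Let p := a + s_of G X.
Let c := e - mu1_of G X.

(** The entry of $\mu$ at $u$ counts the vertices beyond the last neighbour of $u$. Below $p$ it is
    the constant $\mu_1$, so exactly the vertices above $c$ are missed. At $p$ it is zero, so $p$ is
    joined to $e$ and the vertices from $p$ on form a clique. *)
Lemma block_shape : [/\ a < p, p < c, c < e &
  forall u w : 'I_n, a <= u -> u < w -> w <= e -> G u w = ~~ ((u < p) && (c < w))].
Proof.
have ap : a < p by rewrite /p; lia.
have ltn_e t : t <= e -> t < n by move=> h; lia.
(* The last vertex has entry zero, so the search in [s_of] stops inside the sequence. *)
have hlast : nth 0 (mu_seq G X) (e - a) = 0.
  by rewrite (@nth_mu_seq _ (Ordinal en)) /= ?subnn //; lia.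
have hs : s_of G X <= e - a.
  rewrite leqNgt; apply/negP => h; have := before_find 0 h.
  by rewrite hlast eqxx.
have pe : p <= e by rewrite /p; lia.
have mu_p : nth 0 (mu_seq G X) (s_of G X) = 0.
  apply/eqP/(@nth_find _ 0 (fun x => x == 0)); rewrite has_find -/(s_of G X).
  by rewrite size_mu_seq; lia.
have mu_lo (u : 'I_n) : a <= u < p -> (e - u) - deg_gt G X u = mu1_of G X.
  move=> h; rewrite -(@nth_mu_seq (u - a)); [|lia|by rewrite /p in pe h *; lia].
  by apply: mu_const; rewrite /p in h; lia.
have c0 : mu1_of G X <= e - a.
  by have := @mu_lo (Ordinal (ltn_e a ae)) => /=; lia.
have ce : c < e by rewrite /c; lia.
have shape (u w : 'I_n) : a <= u -> u < w -> w <= e -> G u w = ~~ ((u < p) && (c < w)).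
  move=> au uw we; case: (ltnP u p) => up /=.
    have := @mu_lo u; rewrite au up => /(_ isT) hmu.
    by rewrite (deg_gtP au uw we) -leqNgt /c; apply/idP/idP; lia.
  have pn : p < n by apply: ltn_e.
  have hp : nth 0 (mu_seq G X) (s_of G X) = (e - p) - deg_gt G X (Ordinal pn).
    exact: (@nth_mu_seq _ (Ordinal pn)).
  have gpe : G (Ordinal pn) (Ordinal en).
    by rewrite deg_gtP //=; rewrite mu_p in hp; lia.
  by apply: (clique_interval gpe).
(* The consecutive vertices $p-1$ and $p$ are adjacent, but $c<p$ would make them a non-edge. *)
have pc : p <= c.
  have h1 : p.-1 < n by lia.
  have h2 : p < n by lia.
  have := shape (Ordinal h1) (Ordinal h2) => /=.
  have g : G (Ordinal h1) (Ordinal h2) by apply: adjacent => /=; lia.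
  rewrite g; lia.
(* If $p=c$, no edge joins a vertex below $p$ to one above it, and $p$ is a cut vertex separating
   $a$ from $e$. *)
split=> //; rewrite ltn_neqAle pc andbT; apply/eqP => epc.
have pn : p < n by lia.
have an : a < n by lia.
apply: (@no_cut (Ordinal pn)); split; first by rewrite XE /=; lia.
exists (Ordinal an), (Ordinal en); split.
- by rewrite !inE XE -val_eqE /=; lia.
- by rewrite !inE XE -val_eqE /=; lia.
- have : forall d (x : 'I_n), x = a + d :> nat -> x <= e ->
      connect (induced G X) (Ordinal an) x.
    elim=> [|d IH] x hx xe.
      by have -> : Ordinal an = x by apply: val_inj; rewrite /= hx addn0.
    have xn : x.-1 < n by have := ltn_ord x; lia.
    apply: connect_trans (IH (Ordinal xn) _ _) _ => /=; try lia.
    apply: connect1; rewrite /induced /= !XE /= adjacent /=; last by lia.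
    by rewrite andbT; lia.
  by apply; [exact: (esym (subnKC ae)) | ].
apply/negP => /(@connect_inv _ _ (fun t : 'I_n => t < p)) h.
have : e < p; last by lia.
apply: h => //= u t /and3P []; rewrite !inE !XE -!val_eqE /= => hu ht gut up.
rewrite ltnNge; apply/negP => pt.
have ut : u < t by lia.
by move: gut; rewrite (shape u t); lia.
Qed.

End IntervalBlock.
End ClosedConnected.

(** * Blocks and the corner Betti number *)

Section Decomposition.
Variables (n : nat) (G : rel 'I_n) (m : nat).
Variables (B : 'I_m.+1 -> {set 'I_n}) (v : 'I_m -> 'I_n).
Hypothesis Gsimple : simple_graph G.
Hypothesis Gconn : connected_on G [set: 'I_n].
Hypothesis Gclosed : closed_graph G.
Hypothesis cover_e : forall x y : 'I_n, G x y -> exists i, (x \in B i) && (y \in B i).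
Hypothesis no_cut : forall i w, ~ cut_vertex G (B i) w.
Hypothesis consec : forall i : 'I_m,
  B (widen_ord (leqnSn m) i) :&: B (lift ord0 i) = [set v i].
Hypothesis far : forall i j : 'I_m.+1, i.+1 < j -> B i :&: B j = set0.
Hypothesis s1 : forall i, 1 <= s_of G (B i).
Hypothesis mu_const : forall i (l : nat), l < s_of G (B i) ->
  nth 0 (mu_seq G (B i)) l = mu1_of G (B i).
Hypothesis mu1 : forall i, 1 <= mu1_of G (B i).

Lemma block_inter (c d : 'I_m.+1) x : c < d -> x \in B c -> x \in B d ->
  exists i : 'I_m, [/\ c = i :> nat, d = i.+1 :> nat & x = v i].
Proof.
move=> cd xc xd; case: (ltngtP c.+1 d) cd => // [h|h] _.
  by move/setP: (far h) => /(_ x); rewrite !inE xc xd.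
have cm : c < m by have := ltn_ord d; lia.
exists (Ordinal cm); split=> //=.
move/setP: (consec (Ordinal cm)) => /(_ x); rewrite !inE.
have -> : widen_ord (leqnSn m) (Ordinal cm) = c by apply: val_inj.
have -> : lift ord0 (Ordinal cm) = d by apply: val_inj.
by rewrite xc xd => /esym /eqP.
Qed.

(** The union of the blocks up to $b$ and the union of those from $b$ on each have at most one exit
    vertex, so both contain $w$. If $w$ were outside block $b$, it would lie in two blocks on
    opposite sides of $b$, which are disjoint. *)
Lemma block_convex b (u w z : 'I_n) :
  u <= w -> w <= z -> u \in B b -> z \in B b -> w \in B b.
Proof.
move=> uw wz ub zb.
pose L := [pred x | [exists c : 'I_m.+1, (c <= b) && (x \in B c)]].
pose U := [pred x | [exists c : 'I_m.+1, (b <= c) && (x \in B c)]].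
have gL x y : G x y -> L x -> ~~ L y -> exists i : 'I_m, b = i :> nat /\ x = v i.
  move=> /cover_e [d /andP [xd yd]] /existsP [c /andP [cb xc]] Ly.
  have bd : b < d.
    by rewrite ltnNge; apply: contra Ly => db; apply/existsP; exists d; rewrite db.
  have [|i [ci di ex]] := block_inter _ xc xd; first exact: leq_ltn_trans bd.
  by exists i; split=> //; lia.
have gU x y : G x y -> U x -> ~~ U y -> exists i : 'I_m, b = i.+1 :> nat /\ x = v i.
  move=> /cover_e [d /andP [xd yd]] /existsP [c /andP [cb xc]] Uy.
  have bd : d < b.
    by rewrite ltnNge; apply: contra Uy => db; apply/existsP; exists d; rewrite db.
  have [|i [di ci ex]] := block_inter _ xd xc; first exact: leq_trans cb.
  by exists i; split=> //; lia.
have Lw : L w.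
  apply: (convex_gate Gsimple Gconn Gclosed _ uw wz); try by apply/existsP; exists b; rewrite leqnn.
  move=> x y x' y' g1 h1 h2 g2 h3 h4.
  have [i [ei ->]] := gL _ _ g1 h1 h2; have [i' [ei' ->]] := gL _ _ g2 h3 h4.
  by congr v; apply: val_inj; rewrite /= -ei -ei'.
have Uw : U w.
  apply: (convex_gate Gsimple Gconn Gclosed _ uw wz); try by apply/existsP; exists b; rewrite leqnn.
  move=> x y x' y' g1 h1 h2 g2 h3 h4.
  have [i [ei ->]] := gU _ _ g1 h1 h2; have [i' [ei' ->]] := gU _ _ g2 h3 h4.
  by congr v; apply: val_inj => /=; lia.
case/existsP: Lw => c /andP [cb wc]; case/existsP: Uw => d /andP [bd wd].
case: (ltngtP c b) cb => // [ltc _|/val_inj <- _] //.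
case: (ltngtP b d) bd => // [ltd _|/val_inj -> _] //.
have [i [ci di _]] := block_inter (ltn_trans ltc ltd) wc wd.
by lia.
Qed.

Lemma block_interval b : exists q : nat * nat, [/\ q.1 <= q.2, q.2 < n &
  forall x : 'I_n, (x \in B b) = (q.1 <= x <= q.2)].
Proof.
have /set0Pn [x0 hx0] : B b != set0.
  apply: contraTneq (s1 b) => h; rewrite /s_of /mu_seq /sortedV h.
  by rewrite (_ : enum set0 = [::]) //; apply/eqP; rewrite -size_eq0 -cardE cards0.
have [x1 h1 min1] := arg_minnP (fun x : 'I_n => x : nat) hx0.
have [x2 h2 max2] := arg_maxnP (fun x : 'I_n => x : nat) hx0.
exists (x1 : nat, x2 : nat); split=> //=; first exact: min1.
move=> x; apply/idP/andP => [h|[l1 l2]]; first by split; [apply: min1 | apply: max2].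
exact: (block_convex l1 l2 h1 h2).
Qed.

(** The bound $\mu\le e$ keeps the subtraction in [c] from being truncated. The half-open intervals
    partition the labels below [n.-1], since consecutive labels are adjacent and therefore share a
    block; hence the sum of lengths. *)
Lemma block_data : exists a e : 'I_m.+1 -> nat,
  let p b := a b + s_of G (B b) in let c b := e b - mu1_of G (B b) in
  [/\ forall b, [/\ a b < p b, p b < c b, c b < e b, e b < n & mu1_of G (B b) <= e b],
      forall t b b', a b <= t < e b -> a b' <= t < e b' -> b = b',
      forall i j : 'I_n, i < j ->
        (G i j <-> exists b, [/\ a b <= i, j <= e b & ~~ ((i < p b) && (c b < j))])
    & \sum_b (e b - a b) = n.-1].
Proof.
have /fin_all_exists [q hq] := block_interval.
exists (fun b => (q b).1), (fun b => (q b).2) => p c.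
have shape b : [/\ (q b).1 < p b, p b < c b, c b < (q b).2 &
  forall u w : 'I_n, (q b).1 <= u -> u < w -> w <= (q b).2 ->
    G u w = ~~ ((u < p b) && (c b < w))].
  have [h1 h2 h3] := hq b.
  exact: (block_shape Gsimple Gconn Gclosed h2 h1 h3 (s1 b) (@mu_const b) (mu1 b) (@no_cut b)).
have disj t b b' : (q b).1 <= t < (q b).2 -> (q b').1 <= t < (q b').2 -> b = b'.
  (* Otherwise both $t$ and $t+1$ would lie in two different blocks, which share at most one
     vertex. *)
  have key (c1 c2 : 'I_m.+1) : (q c1).1 <= t < (q c1).2 ->
      (q c2).1 <= t < (q c2).2 -> c1 < c2 -> False.
    move=> h1 h2 lt; have [_ e1 i1] := hq c1; have [_ e2 i2] := hq c2.
    have tn : t < n by lia.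
    have tn1 : t.+1 < n by lia.
    have [||i [ci _ ex]] := block_inter (x := Ordinal tn) lt; rewrite ?i1 ?i2 /=; try lia.
    have [||i' [ci' _ ex']] := block_inter (x := Ordinal tn1) lt; rewrite ?i1 ?i2 /=; try lia.
    have ei : i = i' by apply: val_inj; rewrite /= -ci -ci'.
    by move: ex; rewrite ei -ex' => /(congr1 val) /= ; lia.
  move=> h1 h2; case: (ltngtP b b') => [h|h|/val_inj //].
    by case: (key _ _ h1 h2 h).
  by case: (key _ _ h2 h1 h).
split=> //.
- move=> b; have [h1 h2 h3 _] := shape b; have [_ h5 _] := hq b; split=> //.
  by rewrite /c in h2 h3 *; lia.
- move=> i j ij; split.
    move=> g; have [b /andP [hi hj]] := cover_e g; exists b.
    have [_ _ XE] := hq b; move: hi hj; rewrite !XE => /andP [h1 _] /andP [_ h2].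
    by have [_ _ _ <-] := shape b.
  by case=> b [h1 h2 h3]; have [_ _ _ ->] := shape b.
- have -> : \sum_b ((q b).2 - (q b).1) =
      \sum_b \sum_(t < n.-1) ((q b).1 <= t < (q b).2 : nat).
    by apply: eq_bigr => b _; rewrite sum_itv //; have [] := hq b; lia.
  rewrite exchange_big /= -[RHS]card_ord -sum1_card; apply: eq_bigr => t _.
  rewrite -exists_sum; last by move=> b b'; apply: disj.
  have tn := ltn_ord t; have t1 : t < n by lia.
  have t2 : t.+1 < n by lia.
  have [b] : exists b, (Ordinal t1 \in B b) && (Ordinal t2 \in B b).
    by apply: cover_e; apply: (adjacent Gsimple Gconn Gclosed).
  have [_ _ XE] := hq b; rewrite !XE /= => hb.
  by apply/eqP; rewrite eqb1; apply/existsP; exists b; lia.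
Qed.

End Decomposition.

Lemma corner_betti (k : fieldType) (N : nat) (I : {mpoly k[N]} -> Prop) (p r P : nat) :
  0 < P ->
  (forall i j, p < i -> tor_dim I i.+1 j 0) ->
  (forall i j, i + r < j -> tor_dim I i.+1 j 0) ->
  (forall j, j != p + r -> tor_dim I p.+1 j 0) ->
  tor_dim I p.+1 (p + r) P ->
  [/\ is_pd I p, is_reg I r, betti_total I p P & betti I p (p + r) P].
Proof.
move=> P0 hpd hreg hrow hP; split=> //.
- by split=> //; exists (p + r), P.
- by split=> //; exists p, P.
exists (p + r), (fun j => if j == p + r then P else 0); split.
- by move=> j; case: eqP => [->|/eqP /hrow].
- by move=> j h; rewrite gtn_eqF.
by rewrite big_ord_recr /= eqxx big1 // => j _; rewrite ltn_eqF.
Qed.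

(** * The corner of the Betti table, for both ideals at once *)

Section Corner.
Variables (k : fieldType) (n : nat) (G : rel 'I_n) (M : finType).
Variables (a p c e : M -> nat).
Hypothesis ap : forall b, a b < p b.
Hypothesis pc : forall b, p b < c b.
Hypothesis ce : forall b, c b < e b.
Hypothesis en : forall b, e b < n.
Hypothesis disj : forall t b b', a b <= t < e b -> a b' <= t < e b' -> b = b'.
Hypothesis edge : forall i j : 'I_n, i < j ->
  (G i j <-> exists b, [/\ a b <= i, j <= e b & ~~ ((i < p b) && (c b < j))]).
Variables (nfm : 'X_{1..n + n} -> option 'X_{1..n + n}).
Variable I : {mpoly k[n + n]} -> Prop.
Hypothesis nfm_std : forall m, stdm G m -> nfm m = Some m.
Hypothesis nfm_some : forall m m', nfm m = Some m' -> stdm G m' /\ mdeg m' = mdeg m.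
Hypothesis nfm_lt : forall m m', nfm m = Some m' -> ~~ stdm G m ->
  wtm (@ywt n) m' < wtm (@ywt n) m.
Hypothesis I_nf : forall f, I f <-> nf nfm f = 0%R.
Hypothesis I_mulX : forall f t, I f -> I ('X_t * f)%R.
Local Notation PD := (corner_pd a p c e).
Local Notation RG := (corner_reg M).
Local Notation V := (@nonfree n M a p c e).
Local Notation u := (@piece_gen n M a e).
Local Notation key := (@piece_key n M a e).

Lemma free_mul m t : stdm G m -> t \notin V m ->
  [/\ stdm G (m + U_(t))%MM, u (m + U_(t))%MM = u m, V (m + U_(t))%MM = V m
    & key (m + U_(t))%MM = key m].
Proof.
move=> hs ht; have [h1 h2 h3] := nonfree_mul_free ap pc ce edge hs ht.
by rewrite /piece_gen /nonfree /piece_key h2 h3.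
Qed.

Lemma free_div m t : stdm G m -> t \notin V m -> u m t < m t ->
  [/\ stdm G (m - U_(t))%MM, u (m - U_(t))%MM = u m, V (m - U_(t))%MM = V m
    & key (m - U_(t))%MM = key m].
Proof.
move=> hs ht hu; have [h1 h2 h3] := nonfree_div_free ap pc ce en disj hs ht hu.
by rewrite /piece_gen /nonfree /piece_key h2 h3.
Qed.

(** In internal degree [PD + RG], the homological degree [PD.-1] has no critical cells by the bound
    on generators, and [PD.+1] has none by the bound on non-free variables. The critical cells at
    [PD] therefore count the homology. *)
Lemma corner_tor : 2 <= PD ->
  [/\ forall i j, PD <= i -> tor_dim I i.+1 j 0,
      forall i j, i.+1 + RG < j -> tor_dim I i.+1 j 0,
      forall j, j != PD + RG -> tor_dim I PD j 0
    & tor_dim I PD (PD + RG) (\prod_b ((p b - a b) * (e b - c b)))].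
Proof.
move=> hPD.
have hk := piece_key_lt ap pc ce (n := n).
have hu m t (_ : stdm G m) := piece_gen_le ap pc ce (p := p) (c := c) m t.
have hb m t (_ : stdm G m) := nonfree_mul_bound ap pc ce edge (m := m) (t := t).
have t0 j i := tor_dim_crit0 hk hu free_mul hb free_div nfm_std nfm_some nfm_lt I_nf I_mulX
  (j := j) (i := i).
have t1 j i := tor_dim_crit hk hu free_mul hb free_div nfm_std nfm_some nfm_lt I_nf I_mulX
  (j := j) (i := i).
have cPD := crits_corner_pd ap pc ce en disj edge.
have cRG := crits_corner_reg ap pc ce en disj edge.
have c0 := crits_corner0 ap pc ce en disj edge.
have c1 := crits_corner ap pc ce en disj edge.
split.
- by move=> i j h; apply: t0; apply: cPD.
- by move=> i j h; apply: t0; apply: cRG.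
- move=> j h; have := c0 _ h; case: PD hPD => // d _; exact: t0.
rewrite -c1; have h1 := cRG (PD + RG) PD.-1; have h2 := cPD (PD + RG) PD.+1 (ltnSn _).
case: PD hPD h1 h2 => [|[|d]] //= _ h1 h2.
by apply: t1 => //; apply: h1; lia.
Qed.

End Corner.

Theorem theorem4p6 (k : fieldType) (n : nat) (G : rel 'I_n)
    (m : nat) (B : 'I_m.+1 -> {set 'I_n}) (v : 'I_m -> 'I_n) :
  simple_graph G ->
  connected_on G [set: 'I_n] ->
  closed_graph G ->
  (* the cut vertices of G are exactly v_1, ..., v_m (pairwise distinct) *)
  injective v ->
  (forall w, cut_vertex G [set: 'I_n] w <-> exists i, w = v i) ->
  (* G = G_1 u ... u G_{m+1}, G_i the subgraph on V(G_i) = B i *)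
  (forall x : 'I_n, exists i, x \in B i) ->
  (forall x y : 'I_n, G x y -> exists i, (x \in B i) && (y \in B i)) ->
  (* each G_i has no cut vertices *)
  (forall i w, ~ cut_vertex G (B i) w) ->
  (* G_i n G_{i+1} = {v_i} *)
  (forall i : 'I_m, B (widen_ord (leqnSn m) i) :&: B (lift ord0 i) = [set v i]) ->
  (* G_i n G_j = empty for j not in {i-1, i, i+1} *)
  (forall i j : 'I_m.+1, (i.+1 < j)%N -> B i :&: B j = set0) ->
  (* s_i >= 1 and mu_{i1} = ... = mu_{i s_i} =: mu_i >= 1 *)
  (forall i, (1 <= s_of G (B i))%N) ->
  (forall i (l : nat), (l < s_of G (B i))%N ->
       nth 0%N (mu_seq G (B i)) l = mu1_of G (B i)) ->
  (forall i, (1 <= mu1_of G (B i))%N) ->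
  let J := @binom_edge_ideal k n G in
  let inJ := initial_ideal J in
  let P := (\prod_(i < m.+1) (s_of G (B i) * mu1_of G (B i)))%N in
  let r := (2 * m + 3)%N in
  exists p : nat,
    [/\ (p + 3 + \sum_(i < m.+1) (mu1_of G (B i) + s_of G (B i)) = 2 * n)%N,
        [/\ is_pd J p, is_reg J r, betti_total J p P & betti J p (p + r) P] &
        [/\ is_pd inJ p, is_reg inJ r, betti_total inJ p P & betti inJ p (p + r) P]].
Proof.
move=> Gs Gc Gcl _ _ cv ce nc co fa s1 muc mu1 J inJ P r.
have [a [e [hd disj edge hsum]]] := block_data Gs Gc Gcl ce nc co fa s1 muc mu1.
pose p b := a b + s_of G (B b); pose c b := e b - mu1_of G (B b).
have ap b : a b < p b by case: (hd b).
have pc b : p b < c b by case: (hd b).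
have ceb b : c b < e b by case: (hd b).
have en b : e b < n by case: (hd b).
have hmu b : mu1_of G (B b) <= e b by case: (hd b).
have eP : \prod_b ((p b - a b) * (e b - c b)) = P.
  by apply: eq_bigr => b _; congr (_ * _); rewrite /p /c ?addKn //; have := hmu b; lia.
have P0 : 0 < P.
  by rewrite /P; apply: prodn_gt0 => b; rewrite muln_gt0 s1 mu1.
(* In each interval $(e-a)+(c-p)=2(e-a)-\mu-s$, and the lengths $e-a$ add up to $n-1$. *)
have hPD : corner_pd a p c e + \sum_(i < m.+1) (mu1_of G (B i) + s_of G (B i)) = 2 * n.-1.
  rewrite /corner_pd -big_split -hsum big_distrr; apply: eq_bigr => b _ /=.
  by have := pc b; have := ap b; have := ceb b; have := hmu b; rewrite /p /c; lia.
have PD2 : 2 <= corner_pd a p c e.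
  rewrite /corner_pd (bigD1 ord0) //=; have := pc ord0; have := ap ord0; have := ceb ord0.
  by lia.
have n0 : 0 < n by have := en ord0; lia.
have hRG : corner_reg 'I_m.+1 = (2 * m + 2)%N.
  by rewrite /corner_reg sum_nat_const card_ord; lia.
have step (I : {mpoly k[n + n]} -> Prop) :
    [/\ forall i j, corner_pd a p c e <= i -> tor_dim I i.+1 j 0,
      forall i j, i.+1 + corner_reg 'I_m.+1 < j -> tor_dim I i.+1 j 0,
      forall j, j != corner_pd a p c e + corner_reg 'I_m.+1 -> tor_dim I (corner_pd a p c e) j 0
    & tor_dim I (corner_pd a p c e) (corner_pd a p c e + corner_reg 'I_m.+1)
        (\prod_b ((p b - a b) * (e b - c b)))] ->
    [/\ is_pd I (corner_pd a p c e).-1, is_reg I r, betti_total I (corner_pd a p c e).-1 P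
      & betti I (corner_pd a p c e).-1 ((corner_pd a p c e).-1 + r) P].
  (* Passing from $S/I$ to $I$ lowers the homological degree by one and raises the regularity by
     one, so the internal degree of the corner is unchanged. *)
  have er : (corner_pd a p c e).-1 + r = corner_pd a p c e + corner_reg 'I_m.+1 by rewrite hRG /r; lia.
  rewrite eP; case=> h1 h2 h3 h4; apply: corner_betti => //.
  - by move=> i j hi; apply: h1; lia.
  - by move=> i j hi; apply: h2; rewrite hRG; rewrite /r in hi; lia.
  - by move=> j; rewrite er prednK; [apply: h3 | lia].
  - by rewrite er prednK; [ | lia].
exists (corner_pd a p c e).-1; split.
- by lia.
- apply: step; apply: (corner_tor (nfm := fun q => Some (nfJ G q)) ap pc ceb en disj edge) => //.
  + by move=> q hq; rewrite nfJ_std.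
  + by move=> q q' [<-]; apply: nfJ_spec.
  + by move=> q q' [<-] /nfJ_lt [].
  + exact: edge_ideal_nf.
  + exact: edge_ideal_mulX.
apply: step; apply: (corner_tor (nfm := nfin G) ap pc ceb en disj edge) => //.
+ by move=> q hq; rewrite /nfin hq.
+ by move=> q q'; rewrite /nfin; case: ifP => // hq [<-].
+ by move=> q q'; rewrite /nfin => + /negbTE => /[swap] ->.
+ exact: initial_ideal_nf.
+ exact: initial_ideal_mulX.
Qed.
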